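(* Let $G$ be an amenable discrete group. Then $G$ is exact and $G$ satisfies Yu's Property $A$.
   Context: Amenability is understood via F\o lner's condition: $G$ is amenable if there is a F\o lner sequence, i.e. a sequence $(G_n)_{n\in\mathbb{N}}$ of finite nonempty subsets of $G$ such that for every $g\in G$, $\lim_{n\to\infty}\frac{|gG_n\,\triangle\, G_n|}{|G_n|}=0$. Exactness: a discrete group $G$ is exact if for every short exact sequence $0\to B\to C\to D\to 0$ of $G$-$C^*$-algebras (with $G$-equivariant maps) the sequence of reduced crossed products $0\to C^*_r(G,B)\to C^*_r(G,C)\to C^*_r(G,D)\to 0$ is exact. By Kirchberg and Wassermann, for discrete $G$ this is equivalent to exactness of the reduced group $C^*$-algebra $C^*_r(G)$, where a $C^*$-algebra $M$ is exact if $-\otimes_{\min}M$ preserves short exact sequences of $C^*$-algebras. Property $A$: a discrete group $G$ has Property $A$ if for every finite subset $E\subset G$ and every $\epsilon>0$ there exist a finite subset $F\subset G$ and a family $(A_g)_{g\in G}$ of finite nonempty subsets of $G\times\mathbb{N}$ such that (i) $(g,1)\in A_g$ for all $g\in G$; (ii) $|A_g\,\triangle\, A_h|<\epsilon\,|A_g\cap A_h|$ whenever $g^{-1}h\in E$; (iii) if $(h,m)\in A_g$ then $g^{-1}h\in F$. When $G$ is finitely generated, this is Yu's Property $A$ for the metric space $G$ with a word metric $d(g,h)=|g^{-1}h|$ from a finite generating set. *)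

(* Defs.v *)
From HB Require Import structures.
From mathcomp Require Import all_boot all_order all_algebra finmap complex.
From mathcomp Require Import all_classical all_reals all_analysis.

Set Implicit Arguments.
Unset Strict Implicit.
Unset Printing Implicit Defensive.

Import Order.TTheory GRing.Theory Num.Theory numFieldNormedType.Exports.

Local Open Scope classical_set_scope.
Local Open Scope ring_scope.
Local Open Scope complex_scope.

Definition fset_symdiff (K : choiceType) (A B : {fset K}) : {fset K} :=
  ((A `\` B) `|` (B `\` A))%fset.

Definition left_translate (G : groupType) (g : G) (A : {fset G}) : {fset G} :=
  [fset (g * x)%g | x in A]%fset.

Definition folner_sequence (R : realType) (G : groupType)
    (F : nat -> {fset G}) : Prop :=
  (forall n, F n != fset0) /\
  (forall g : G,
     (#|` fset_symdiff (left_translate g (F n)) (F n) |%:R / #|` F n |%:R : R)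
       @[n --> \oo] --> (0 : R)).

Definition amenable (R : realType) (G : groupType) : Prop :=
  exists F : nat -> {fset G}, folner_sequence R F.

Definition property_A (R : realType) (G : groupType) : Prop :=
  forall (E : {fset G}) (eps : R), 0 < eps ->
  exists (F : {fset G}) (A : G -> {fset G * nat}),
    [/\ forall g, A g != fset0,
        forall g, (g, 1%N) \in A g,
        forall g h, (g^-1 * h)%g \in E ->
          #|` fset_symdiff (A g) (A h) |%:R < eps * #|` (A g `&` A h)%fset |%:R
      & forall g h m, (h, m) \in A g -> (g^-1 * h)%g \in F].

(* No unit: the ideal B of an extension 0 -> B -> C -> D -> 0 is usually
   non-unital. *)
HB.mixin Record isCStarAlgebra (R : realType) A of CompleteNormedModule R[i] A := {
  cmul : A -> A -> A;
  cstar : A -> A;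
  cmulA : associative cmul;
  cmulDl : left_distributive cmul +%R;
  cmulDr : right_distributive cmul +%R;
  cmulZl : forall (a : R[i]) x y, cmul (a *: x) y = a *: cmul x y;
  cmulZr : forall (a : R[i]) x y, cmul x (a *: y) = a *: cmul x y;
  cstarD : {morph cstar : x y / x + y};
  cstarZ : forall (a : R[i]) x, cstar (a *: x) = a^*%C *: cstar x;
  cstarM : forall x y, cstar (cmul x y) = cmul (cstar y) (cstar x);
  cstarK : involutive cstar;
  cnormM : forall x y, `|cmul x y| <= `|x| * `|y|;
  cnorm_cstar : forall x, `|cmul (cstar x) x| = `|x| ^+ 2
}.

#[short(type="cstarAlgType")]
HB.structure Definition CStarAlgebra (R : realType) :=
  {A of isCStarAlgebra R A & CompleteNormedModule R[i] A}.

(* The norm of a normed module over R[i] has values in R[i]. *)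
Definition rnorm (R : realType) (A : cstarAlgType R) (x : A) : R :=
  complex.Re `|x|.

Definition star_hom (R : realType) (A B : cstarAlgType R) (phi : A -> B) : Prop :=
  [/\ forall (a : R[i]) x y, phi (a *: x + y) = a *: phi x + phi y,
      forall x y, phi (cmul x y) = cmul (phi x) (phi y)
    & forall x, phi (cstar x) = cstar (phi x)].

(* The two action laws make every [gact g] an automorphism. *)
HB.mixin Record isGCStarAlgebra (R : realType) (G : groupType) A
    of CStarAlgebra R A := {
  gact : G -> A -> A;
  gact_hom : forall g, star_hom (gact g);
  gact1 : forall x, gact 1%g x = x;
  gactM : forall g h x, gact (g * h)%g x = gact g (gact h x)
}.

#[short(type="gcstarAlgType")]
HB.structure Definition GCStarAlgebra (R : realType) (G : groupType) :=
  {A of isGCStarAlgebra R G A & CStarAlgebra R A}.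

Definition equivariant_hom (R : realType) (G : groupType)
    (A B : gcstarAlgType R G) (phi : A -> B) : Prop :=
  star_hom phi /\ forall (g : G) (x : A), phi (gact g x) = gact g (phi x).

(** C*_r(G, A) is the completion of the algebra C_c(G, A) of finitely supported
    functions for the operator norm of the regular representation on the
    Hilbert A-module l^2(G, A), whose inner product is
      <xi, eta> = sum_g xi(g)^* eta(g).
    That representation is the integrated form of the covariant pair
      (a xi)(g) = g^-1.a xi(g)   and   (lambda_k xi)(g) = xi(k^-1 g). *)

Section reduced_crossed_product.
Variables (R : realType) (G : groupType).

Section algebra.
Variable A : gcstarAlgType R G.

Definition Cc : set (G -> A) := [set f | finite_set [set g | f g != 0]].

Definition regular_rep (f xi : G -> A) : G -> A :=
  fun g => \sum_(k \in [set: G]) cmul (gact g^-1%g (f k)) (xi (k^-1 * g)%g).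

Definition l2norm (xi : G -> A) : R :=
  Num.sqrt (rnorm (\sum_(g \in [set: G]) cmul (cstar (xi g)) (xi g))).

(* Finitely supported vectors are dense in l^2(G, A), so the supremum over
   those of norm at most 1 is the operator norm. *)
Definition reduced_norm (f : G -> A) : R :=
  sup [set l2norm (regular_rep f xi) | xi in [set xi | Cc xi /\ l2norm xi <= 1]].

Definition reduced_cauchy (u : nat -> G -> A) : Prop :=
  (forall n, Cc (u n)) /\
  forall eps : R, 0 < eps -> exists N : nat, forall m n : nat,
    (N <= m)%N -> (N <= n)%N -> reduced_norm (u m \- u n) < eps.

Definition reduced_class (u : nat -> G -> A) : set (nat -> G -> A) :=
  [set v | reduced_cauchy v /\ reduced_norm (u n \- v n) @[n --> \oo] --> (0 : R)].

(* The completion: its points are the classes of Cauchy sequences modulo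
   null sequences. *)
Definition crossed_product : set (set (nat -> G -> A)) :=
  [set reduced_class u | u in reduced_cauchy].

Definition crossed_product0 : set (nat -> G -> A) :=
  reduced_class (fun _ _ => 0).

End algebra.

(* The extension to the completions of f |-> phi \o f : it sends the class of u
   to the class of (phi \o u n)_n. *)
Definition crossed_product_map (A B : gcstarAlgType R G) (phi : A -> B)
    (X : set (nat -> G -> A)) : set (nat -> G -> B) :=
  \bigcup_(u in X) reduced_class (fun n => phi \o u n).

End reduced_crossed_product.

(* 0 -> B -> C -> D -> 0, the three terms being given as sets of points and
   [zD] being the zero of D. *)
Definition short_exact (X Y Z : Type) (B : set X) (C : set Y) (D : set Z)
    (zD : Z) (phi : X -> Y) (psi : Y -> Z) : Prop :=
  [/\ set_inj B phi,
      phi @` B = [set y | C y /\ psi y = zD]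
    & psi @` C = D].

Definition exact_group (R : realType) (G : groupType) : Prop :=
  forall (B C D : gcstarAlgType R G) (phi : B -> C) (psi : C -> D),
    equivariant_hom phi -> equivariant_hom psi ->
    short_exact [set: B] [set: C] [set: D] 0 phi psi ->
    short_exact (@crossed_product R G B) (@crossed_product R G C)
      (@crossed_product R G D) (@crossed_product0 R G D)
      (crossed_product_map phi) (crossed_product_map psi).

(* Main.v *)
Require Import Defs.
From mathcomp Require Import all_boot all_order all_algebra finmap complex.
From mathcomp Require Import all_classical all_reals all_analysis.
From mathcomp Require Import ring lra zify.

(** Let [F] be a finite subset of [G]. Compressing the regular representation
    to [F] sends [f] to the matrix [T_F(f) = (g^-1 . f (g h^-1))] indexed by [F],
    and the reduced norm of [f] is the supremum of the norms of these matrices.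
    Conversely, averaging along the diagonals of a matrix [Y] indexed by [F]
    gives a finitely supported function [M_F(Y)] with [|M_F(Y)| <= |Y|], because
    [Y] is sent by a *-homomorphism to the block diagonal matrix of the
    translates [x^-1 . Y], of which [M_F(Y)] is a compression. If [F] runs along a
    Folner sequence, [M_F(T_F(f))] tends to [f].

    Let [0 -> B -> C -> D -> 0] be exact and let [f] be a finitely supported
    function with values in [C]. A *-homomorphism of matrix algebras lifts
    with a bound on norms, so that [T_F(f)] has the same image over [D] as some
    [T] with [|T| <= 2 |psi f| + eps]. The difference [T_F(f) - T] comes from [B],
    and averaging it shows that [f] is at distance at most [2 |psi f| + 2 eps]
    from the functions with values in [B]. Exactness in the middle and
    surjectivity follow, the latter by summing lifts of increments.

    Property A holds with [A_g = (g F x0^-1) x {1}], for [F] a Folner set and [x0]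
    in [F]. *)

Set Implicit Arguments.
Unset Strict Implicit.
Unset Printing Implicit Defensive.

Import Order.TTheory GRing.Theory Num.Theory numFieldNormedType.Exports.

Local Open Scope classical_set_scope.
Local Open Scope ring_scope.
Local Open Scope complex_scope.

(** For a general group the kernel of the map induced by [psi] may be larger than the closure of the
    functions with values in [B]; the task is to turn a small image over [D] into nearness to that
    ideal. Matrices help because an exact sequence stays exact entry by entry, so that only a
    quantitative fact, a lift with controlled norm, needs C*-theory. That theory is built from the
    C*-identity alone, without spectrum or functional calculus: square roots, inverses of
    [1 + h ^ 2] and truncations are limits of explicit iterations. Ideals lack units, so positivity
    is proved in a unitization and pulled back. The factor 2 comes from lifting real and imaginary
    parts separately; any constant independent of [F] would do, since the completions only see
    Cauchy and null sequences. The same lift, applied to an injective map, bounds its norm from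
    below and yields injectivity on the completions. *)

Section linear_identities.
Variables (K : pzRingType) (V : lmodType K).

Inductive lexp :=
  | LZero | LVar of nat | LAdd of lexp & lexp | LOpp of lexp
  | LScale of K & lexp | LMuln of lexp & nat.

Fixpoint leval (e : seq V) (t : lexp) : V :=
  match t with
  | LZero => 0
  | LVar n => nth 0 e n
  | LAdd a b => leval e a + leval e b
  | LOpp a => - leval e a
  | LScale k a => k *: leval e a
  | LMuln a n => leval e a *+ n
  end.

(** [Nat.eqb] is used because [lmod_pre] unfolds it by [cbn] on concrete indices, leaving only ring
    equations between coefficients. *)
Fixpoint lcoef (t : lexp) (i : nat) : K :=
  match t with
  | LZero => 0
  | LVar n => if Nat.eqb n i then 1 else 0
  | LAdd a b => lcoef a i + lcoef b i
  | LOpp a => - lcoef a i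
  | LScale k a => k * lcoef a i
  | LMuln a n => n%:R * lcoef a i
  end.

Fixpoint leq_coefs (n : nat) (s t : lexp) : Prop :=
  if n is n'.+1 then lcoef s n' = lcoef t n' /\ leq_coefs n' s t else True.

Lemma leval_coef (e : seq V) (t : lexp) :
  leval e t = \sum_(i < size e) lcoef t i *: nth 0 e i.
Proof.
elim: t => [|n|a IHa b IHb|a IHa|k a IHa|a IHa n] /=.
- by rewrite big1 // => i _; rewrite scale0r.
- have [n_lt|n_ge] := ltnP n (size e); last first.
    rewrite nth_default // big1 // => i _; case: PeanoNat.Nat.eqb_spec => [E|_].
      by move: (ltn_ord i); rewrite -E ltnNge n_ge.
    by rewrite scale0r.
  rewrite (bigD1 (Ordinal n_lt)) //= PeanoNat.Nat.eqb_refl scale1r big1 ?addr0 //.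
  move=> i /eqP ni; case: PeanoNat.Nat.eqb_spec => [E|_]; last by rewrite scale0r.
  by case: ni; apply: val_inj.
- by rewrite IHa IHb -big_split; apply: eq_bigr => i _; rewrite scalerDl.
- by rewrite IHa -sumrN; apply: eq_bigr => i _; rewrite scaleNr.
- by rewrite IHa scaler_sumr; apply: eq_bigr => i _; rewrite scalerA.
- rewrite IHa -sumrMnl; apply: eq_bigr => i _.
  by rewrite -scaler_nat scalerA.
Qed.

Lemma leval_eq (e : seq V) (s t : lexp) :
  leq_coefs (size e) s t -> leval e s = leval e t.
Proof.
move=> H; rewrite !leval_coef; apply: eq_bigr => i _; congr (_ *: _).
case: i; elim: (size e) H => //= n IHn [Hn Hlt] m.
by rewrite ltnS leq_eqVlt => /predU1P[-> //|]; exact: IHn.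
Qed.

End linear_identities.

(* [lmod] proves an equality between linear combinations in a left module, up
   to an equality of coefficients left to [ring]. *)
Ltac lm_mem x l :=
  lazymatch l with
  | nil => false
  | x :: _ => true
  | _ :: ?l' => lm_mem x l'
  end.
Ltac lm_atoms t l :=
  lazymatch t with
  | 0 => l
  | ?a + ?b => let l := lm_atoms a l in lm_atoms b l
  | - ?a => lm_atoms a l
  | ?k *: ?a => lm_atoms a l
  | ?a *+ ?n => lm_atoms a l
  | ?x => match lm_mem x l with true => l | false => constr:(x :: l) end
  end.
Ltac lm_index x l :=
  lazymatch l with
  | x :: _ => constr:(O)
  | _ :: ?l' => let n := lm_index x l' in constr:(S n)
  end.
Ltac lm_quote K t l :=
  lazymatch t with
  | 0 => constr:(@LZero K)
  | ?a + ?b =>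
      let a := lm_quote K a l in let b := lm_quote K b l in constr:(LAdd a b)
  | - ?a => let a := lm_quote K a l in constr:(LOpp a)
  | ?k *: ?a => let a := lm_quote K a l in constr:(LScale k a)
  | ?a *+ ?n => let a := lm_quote K a l in constr:(LMuln a n)
  | ?x => let n := lm_index x l in constr:(LVar K n)
  end.
Ltac lmod_pre :=
  lazymatch goal with
  | |- @eq ?T ?s ?t =>
    (* Elaborating an empty list against [Lmodule.sort _] makes unification find the scalars and the
       module structure of [T]. *)
    let nilV := constr:((@nil T) : seq (GRing.Lmodule.sort _)) in
    lazymatch type of nilV with
    | seq (@GRing.Lmodule.sort ?K ?V) =>
      let l := lm_atoms s (@nil (@GRing.Lmodule.sort K V)) in
      let l := lm_atoms t l in
      let s' := lm_quote K s l in
      let t' := lm_quote K t l in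
      refine (@leval_eq K V l s' t' _);
      cbn [leq_coefs lcoef size Nat.eqb]
    end
  end.
Ltac lmod := lmod_pre; repeat split; ring.


(** * C*-algebras with a real-valued norm *)

Definition seq_cauchy (R : realType) (V : zmodType) (p : V -> R) (u : nat -> V) :=
  forall eps : R, 0 < eps -> exists N : nat, forall m n : nat,
    (N <= m)%N -> (N <= n)%N -> p (u m - u n) < eps.

(* A C*-algebra as a bare involutive algebra with a complete real norm; matrix
   algebras and unitizations are built in this form, without topology. *)
Record calg (R : realType) := CAlg {
  csort :> lmodType R[i];
  amul : csort -> csort -> csort;
  astar : csort -> csort;
  anorm : csort -> R;
  amulA : associative amul;
  amulDl : left_distributive amul +%R;
  amulDr : right_distributive amul +%R;
  amulZl : forall (a : R[i]) x y, amul (a *: x) y = a *: amul x y;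
  amulZr : forall (a : R[i]) x y, amul x (a *: y) = a *: amul x y;
  astarD : {morph astar : x y / x + y};
  astarZ : forall (a : R[i]) x, astar (a *: x) = a^*%C *: astar x;
  astarM : forall x y, astar (amul x y) = amul (astar y) (astar x);
  astarK : involutive astar;
  anorm_ge0 : forall x, 0 <= anorm x;
  anorm_eq0 : forall x, anorm x = 0 -> x = 0;
  anormD : forall x y, anorm (x + y) <= anorm x + anorm y;
  anormZ : forall (a : R[i]) x, anorm (a *: x) = complex.Re `|a| * anorm x;
  anormM : forall x y, anorm (amul x y) <= anorm x * anorm y;
  anorm_sqr_le : forall x, anorm x ^+ 2 <= anorm (amul (astar x) x);
  acomplete : forall u : nat -> csort, seq_cauchy anorm u ->
    exists l, anorm (u n - l) @[n --> \oo] --> (0 : R)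
}.

Reserved Notation "x ** y" (at level 40, left associativity).
Reserved Notation "x ^#" (at level 2, format "x ^#").
Notation "x ** y" := (amul x y) : ring_scope.
Notation "x ^#" := (astar x) : ring_scope.
Notation nm := (@anorm _ _).

Section calg_basics.
Variables (R : realType) (A : calg R).
Implicit Types (x y z : A) (u v : nat -> A) (r : R).

Lemma amul0l x : 0 ** x = 0.
Proof. by have := amulZl 0 (0 : A) x; rewrite !scale0r. Qed.
Lemma amul0r x : x ** 0 = 0.
Proof. by have := amulZr 0 x (0 : A); rewrite !scale0r. Qed.
Lemma amulNl x y : (- x) ** y = - (x ** y).
Proof. by rewrite -scaleN1r amulZl scaleN1r. Qed.
Lemma amulNr x y : x ** (- y) = - (x ** y).
Proof. by rewrite -scaleN1r amulZr scaleN1r. Qed.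
Lemma amulBl x y z : (x - y) ** z = x ** z - y ** z.
Proof. by rewrite amulDl amulNl. Qed.
Lemma amulBr x y z : x ** (y - z) = x ** y - x ** z.
Proof. by rewrite amulDr amulNr. Qed.
Lemma astar0 : (0 : A)^# = 0.
Proof. by have := astarZ 0 (0 : A); rewrite conjc0 !scale0r. Qed.
Lemma astarN x : (- x)^# = - x^#.
Proof. by rewrite -scaleN1r astarZ rmorphN1 scaleN1r. Qed.
Lemma astarB x y : (x - y)^# = x^# - y^#.
Proof. by rewrite astarD astarN. Qed.
Lemma astarZr r x : (r%:C *: x)^# = r%:C *: x^#.
Proof. by rewrite astarZ conjc_real. Qed.
Lemma astar_sum (I : Type) (s : seq I) (P : pred I) (F : I -> A) :
  (\sum_(i <- s | P i) F i)^# = \sum_(i <- s | P i) (F i)^#.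
Proof. exact: (big_morph (@astar _ A) (@astarD _ A) astar0). Qed.
Lemma amul_suml (I : Type) (s : seq I) (P : pred I) (F : I -> A) y :
  (\sum_(i <- s | P i) F i) ** y = \sum_(i <- s | P i) F i ** y.
Proof. exact: (big_morph (fun x => x ** y) (fun x z => amulDl x z y) (amul0l y)). Qed.
Lemma amul_sumr (I : Type) (s : seq I) (P : pred I) (F : I -> A) y :
  y ** (\sum_(i <- s | P i) F i) = \sum_(i <- s | P i) y ** F i.
Proof. exact: (big_morph (amul y) (amulDr y) (amul0r y)). Qed.

Definition amulE :=
  (amulDl, amulDr, amulNl, amulNr, amulZl, amulZr, amul0l, amul0r, amulA).
Definition astarE := (astarD, astarN, astar0, astarZ, astarM, astarK).

Lemma anormZr r x : nm (r%:C *: x) = `|r| * nm x.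
Proof. by rewrite anormZ normc_def /= expr0n addr0 sqrtr_sqr. Qed.
Lemma anormZi x : nm ('i%C *: x) = nm x.
Proof. by rewrite anormZ normc_def /= expr0n expr1n add0r sqrtr1 mul1r. Qed.
Lemma anorm0 : nm (0 : A) = 0.
Proof. by have := anormZ 0 (0 : A); rewrite scale0r normr0 mul0r. Qed.
Lemma anormN x : nm (- x) = nm x.
Proof. by rewrite -scaleN1r anormZ normrN1 mul1r. Qed.
Lemma anormB x y : nm (x - y) <= nm x + nm y.
Proof. by rewrite -(anormN y) anormD. Qed.
Lemma anorm_distC x y : nm (x - y) = nm (y - x).
Proof. by rewrite -opprB anormN. Qed.
Lemma anorm_sum (I : Type) (s : seq I) (P : pred I) (F : I -> A) :
  nm (\sum_(i <- s | P i) F i) <= \sum_(i <- s | P i) nm (F i).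
Proof.
elim/big_rec2: _ => [|i r x _ le_xr]; first by rewrite anorm0.
by rewrite (le_trans (anormD _ _)) // lerD2l.
Qed.
Lemma anorm_le0 x : nm x <= 0 -> x = 0.
Proof.
by move=> x0; apply: anorm_eq0; apply/eqP; rewrite eq_le x0 anorm_ge0.
Qed.
Lemma ler_anormB x y : nm x - nm y <= nm (x - y).
Proof. by rewrite lerBlDr -{1}(subrK y x) anormD. Qed.

(** The C*-inequality and submultiplicativity give [|x|^2 <= |x^#| |x|]; cancel [|x|], then exchange
    [x] and [x^#]. *)
Lemma anorm_star x : nm x^# = nm x.
Proof.
suff le x' : nm x' <= nm x'^# by apply/eqP; rewrite eq_le -{2}(astarK x) !le.
have := anorm_ge0 x'; rewrite le_eqVlt => /predU1P[<-|x_gt0]; first exact: anorm_ge0.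
rewrite -(ler_pM2r x_gt0) -expr2 (le_trans (anorm_sqr_le _)) //.
exact: anormM.
Qed.

Lemma anorm_sqr x : nm (x^# ** x) = nm x ^+ 2.
Proof.
apply/eqP; rewrite eq_le anorm_sqr_le andbT.
by rewrite (le_trans (anormM _ _)) // anorm_star.
Qed.

Lemma anorm_sqr_sa x : x^# = x -> nm (x ** x) = nm x ^+ 2.
Proof. by move=> sx; rewrite -anorm_sqr sx. Qed.

Definition cvg_nm u x := nm (u n - x) @[n --> \oo] --> (0 : R).

Lemma cvg_nm_le u x (e : nat -> R) :
  (forall n, nm (u n - x) <= e n) -> e @ \oo --> 0 -> cvg_nm u x.
Proof.
move=> le_e e0; apply: (@squeeze_cvgr _ _ _ _ (fun=> 0) e) => //; last exact: cvg_cst.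
by apply: nearW => n; rewrite anorm_ge0 le_e.
Qed.

Lemma cvg_nm_unique u x y : cvg_nm u x -> cvg_nm u y -> x = y.
Proof.
move=> ux uy; apply/subr0_eq/anorm_le0.
have e0 : (nm (u n - x) + nm (u n - y)) @[n --> \oo] --> 0 + 0 by exact: cvgD.
rewrite addr0 in e0; have -> : 0 = lim ((nm (u n - x) + nm (u n - y)) @[n --> \oo]).
  by apply/esym/cvg_lim.
apply: limr_ge; first by apply/cvg_ex; exists 0.
apply: nearW => n; rewrite -(anormN (u n - x)) (le_trans _ (anormD _ _)) //.
by rewrite opprB addrA subrK.
Qed.

Lemma cvg_nm_lip u x (B : calg R) (F : A -> B) (k : R) :
  (forall n, nm (F (u n) - F x) <= k * nm (u n - x)) ->
  cvg_nm u x -> anorm (F (u n) - F x) @[n --> \oo] --> (0 : R).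
Proof.
move=> lip ux; apply: (@squeeze_cvgr _ _ _ _ (fun=> 0) (fun n => k * nm (u n - x))).
- by apply: nearW => n; rewrite anorm_ge0 lip.
- exact: cvg_cst.
- by rewrite -(mulr0 k); apply: cvgM => //; exact: cvg_cst.
Qed.

Lemma cvg_nm_shift u x : cvg_nm u x -> cvg_nm (fun n => u n.+1) x.
Proof. by move=> ux; rewrite /cvg_nm (cvg_shiftS (fun n => nm (u n - x))). Qed.

End calg_basics.

(** * Square roots, contractive homomorphisms, positivity *)

(** The majorant method. Only symmetry along [u] is asked of [p], because it also serves for
    [reduced_norm], which is controlled on [Cc] only. *)
Lemma seq_cauchy_dominated (R : realType) (V : zmodType) (p : V -> R)
    (u : nat -> V) (b : nat -> R) :
  (forall m n, p (u m - u n) = p (u n - u m)) -> cvgn b ->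
  (forall m n, (m <= n)%N -> p (u n - u m) <= b n - b m) -> seq_cauchy p u.
Proof.
move=> pC cb pb eps eps0.
have /cauchy_cvgP/cauchy_ballP := cb; move=> /(_ eps eps0).
rewrite near_map2 => -[] /= [P Q] /= [[N1 _ hN1] [N2 _ hN2]] PQ.
exists (maxn N1 N2) => m n; rewrite !geq_max => /andP[m1 m2] /andP[n1 n2].
have lt_eps i j : (i <= j)%N -> `|b i - b j| < eps -> p (u j - u i) < eps.
  move=> ij lt; rewrite (le_lt_trans (pb _ _ ij)) // (le_lt_trans (ler_norm _)) //.
  by rewrite distrC.
have [mn|/ltnW nm] := leqP m n.
  by rewrite pC; apply: lt_eps => //; apply: (PQ (m, n)); split; [exact: hN1|exact: hN2].
by apply: lt_eps => //; apply: (PQ (n, m)); split; [exact: hN1|exact: hN2].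
Qed.

Section fixed_points.
Variables (R : realType) (A : calg R).
Implicit Types (x y z : A) (u : nat -> A).

Lemma acomplete_dominated u (b : nat -> R) : cvgn b ->
  (forall n, nm (u n.+1 - u n) <= b n.+1 - b n) -> exists l, cvg_nm u l.
Proof.
move=> cb ub; apply: acomplete; apply: (seq_cauchy_dominated (b := b)) => //.
  by move=> m n; exact: anorm_distC.
move=> m n; elim: n => [|n IHn]; first by rewrite leqn0 => /eqP ->; rewrite !subrr anorm0.
rewrite leq_eqVlt => /predU1P[->|]; first by rewrite !subrr anorm0.
rewrite ltnS => /IHn le_mn.
have -> : u n.+1 - u m = (u n.+1 - u n) + (u n - u m) by rewrite addrA subrK.
have -> : b n.+1 - b m = (b n.+1 - b n) + (b n - b m) by rewrite addrA subrK.
by rewrite (le_trans (anormD _ _)) // lerD.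
Qed.

Lemma additive_contraction_fixpoint (T : A -> A) (q : R) (b : A) :
  0 <= q < 1 -> {morph T : x y / x - y} -> (forall x, nm (T x) <= q * nm x) ->
  exists x, x = b + T x.
Proof.
(* The sequence [c] below is chosen so that [c n.+1 - c n = |u 1| q^n], the geometric bound on the
   increments of [u]. *)
move=> /andP[q0 q1] TB Tq; pose u := fix u n := if n is n'.+1 then b + T (u n') else 0.
pose c n := - (nm (u 1%N) / (1 - q)) * q ^+ n.
have [||x ux] := @acomplete_dominated u c.
- apply: is_cvgM; first exact: is_cvg_cst.
  by apply/cvg_ex; exists 0; apply: cvg_expr; rewrite ger0_norm.
- move=> n; have -> : c n.+1 - c n = nm (u 1%N) * q ^+ n.
    by rewrite /c exprS; field; rewrite subr_eq0 gt_eqF.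
  elim: n => [|n IHn]; first by rewrite expr0 mulr1 /= subr0.
  have -> : u n.+2 - u n.+1 = T (u n.+1 - u n).
    by rewrite TB /= opprD addrACA subrr add0r.
  by rewrite (le_trans (Tq _)) // exprS mulrCA ler_wpM2l.
exists x; apply: (@cvg_nm_unique _ _ (fun n => u n.+1)); first exact: cvg_nm_shift.
apply: (@cvg_nm_lip _ _ u x A (fun y => b + T y) q) => // n.
by rewrite opprD addrACA subrr add0r -TB.
Qed.

Lemma additive_contraction_unique (T : A -> A) (q : R) (b x y : A) :
  q < 1 -> {morph T : x y / x - y} -> (forall x, nm (T x) <= q * nm x) ->
  x = b + T x -> y = b + T y -> x = y.
Proof.
move=> q1 TB Tq xT yT; apply/subr0_eq/anorm_le0.
have : nm (x - y) <= q * nm (x - y).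
  by rewrite {1}xT {1}yT opprD addrACA subrr add0r -TB.
by rewrite -subr_ge0 -{2}(mul1r (nm _)) -mulrBl nmulr_rge0 // subr_lt0.
Qed.

Lemma cvg_nmM u v x y : cvg_nm u x -> cvg_nm v y -> cvg_nm (fun n => u n ** v n) (x ** y).
Proof.
move=> ux vy; pose e n := nm (u n - x) * nm (v n - y) + (nm x * nm (v n - y) + nm (u n - x) * nm y).
apply: (@cvg_nm_le _ _ _ _ e) => [n|].
  have -> : u n ** v n - x ** y =
      (u n - x) ** (v n - y) + (x ** (v n - y) + (u n - x) ** y).
    by rewrite !amulE; lmod.
  by rewrite (le_trans (anormD _ _)) ?lerD ?anormM ?(le_trans (anormD _ _)) ?lerD ?anormM.
have -> : 0 = 0 * 0 + (nm x * 0 + 0 * nm y) :> R by rewrite !mulr0 mul0r !addr0.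
by apply: cvgD; [exact: cvgM|apply: cvgD; apply: cvgM => //; exact: cvg_cst].
Qed.

Lemma cvg_nm_cst x : cvg_nm (fun=> x) x.
Proof. by apply: (@cvg_nm_le _ _ _ _ (fun=> 0)) => [n|]; [rewrite subrr anorm0|exact: cvg_cst]. Qed.

Lemma cvg_nm_bound u x (k : R) : cvg_nm u x -> (forall n, nm (u n) <= k) -> nm x <= k.
Proof.
move=> ux uk; rewrite -subr_le0.
have -> : 0 = lim (nm (u n - x) @[n --> \oo]) by apply/esym/cvg_lim.
apply: limr_ge; first by apply/cvg_ex; exists 0.
apply: nearW => n; rewrite anorm_distC (le_trans _ (ler_anormB _ _)) //.
by rewrite lerD2l lerN2.
Qed.

(* The iteration [s = (y + s ^ 2) / 2] is dominated by the real iteration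
   [a = (1 + a ^ 2) / 2]; its limit is [1 - sqrt (1 - y)]. *)
Lemma exists_one_minus_sqrt y : y^# = y -> nm y <= 1 ->
  exists s, [/\ s^# = s, nm s <= 1, 2%:R *: s = y + s ** s
     & forall x, x ** y = y ** x -> x ** s = s ** x].
Proof.
move=> ysa y1.
pose a := fix a n : R := if n is n'.+1 then (1 + a n' ^+ 2) / 2 else 0.
pose F z := 2^-1%:C *: (y + z ** z).
pose u := fix u n := if n is n'.+1 then F (u n') else 0.
have a01 n : 0 <= a n <= 1.
  elim: n => [|n /andP[an0 an1]] /=; first by rewrite lexx ler01.
  by nra.
have a_nd n : a n <= a n.+1 by have /= := a01 n; nra.
have ua n : nm (u n) <= a n.
  elim: n => [|n IHn] /=; first by rewrite anorm0.
  rewrite anormZr ger0_norm ?invr_ge0 // mulrC ler_wpM2r ?invr_ge0 //.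
  rewrite (le_trans (anormD _ _)) // lerD // (le_trans (anormM _ _)) // -expr2.
  by rewrite lerXn2r ?nnegrE ?anorm_ge0 //; have /andP[] := a01 n.
have half : 2^-1%:C + 2^-1%:C = 1 :> R[i].
  by apply/eqP; rewrite eq_complex /= addr0 eqxx andbT; apply/eqP; field.
(* A difference of squares without commutativity. It mirrors the scalar identity for [a], so the
   increments of [u] are dominated by those of [a]. *)
have FB z1 z2 : F z1 - F z2 = 2^-1%:C *: (z1 ** (z1 - z2) + (z1 - z2) ** z2).
  by rewrite /F !amulE; lmod.
have [||s us] := @acomplete_dominated u a.
- apply: nondecreasing_is_cvgn; first exact/nondecreasing_seqP.
  by exists 1 => _ [n _ <-]; have /andP[] := a01 n.
- elim=> [|n IHn]; first by rewrite [u 0]/= [a 0]/= !subr0; exact: ua.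
  have -> : u n.+2 - u n.+1 = F (u n.+1) - F (u n) by [].
  rewrite FB anormZr ger0_norm ?invr_ge0 //.
  have -> : a n.+2 - a n.+1 = 2^-1 * (a n.+1 * (a n.+1 - a n) + (a n.+1 - a n) * a n).
    by rewrite /=; field.
  rewrite ler_wpM2l ?invr_ge0 // (le_trans (anormD _ _)) //.
  by rewrite lerD // (le_trans (anormM _ _)) // ler_pM ?anorm_ge0.
exists s; split.
- apply: (cvg_nm_unique _ us); apply: (@cvg_nm_le _ _ _ _ (fun n => nm (u n - s))) => // n.
  have -> : u n - s^# = (u n - s)^#; last by rewrite anorm_star.
  rewrite astarB; congr (_ - _); elim: n => [|n IHn] /=; first by rewrite astar0.
  by rewrite /F astarZr astarD astarM -IHn ysa.
- by apply: cvg_nm_bound us _ => n; rewrite (le_trans (ua n)) //; have /andP[] := a01 n.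
- have F_s : F s = s.
    apply/esym/(cvg_nm_unique (cvg_nm_shift us)) => /=.
    apply: (@cvg_nm_lip _ _ (fun n => u n ** u n) (s ** s) A
      (fun z => 2^-1%:C *: (y + z)) 2^-1); last exact: cvg_nmM.
    move=> n; rewrite -scalerBr opprD addrACA subrr add0r anormZr.
    by rewrite ger0_norm ?invr_ge0.
  rewrite -{1}F_s /F scalerA.
  have -> : 2%:R * 2^-1%:C = 1 :> R[i] by rewrite mulr_natl mulr2n.
  by rewrite scale1r.
(* Commutation passes to the iterates and to their limit; it replaces membership of [s] in the
   closed algebra generated by [y]. *)
- move=> x xy.
  have xu n : x ** u n = u n ** x.
    elim: n => [|n IHn] /=; first by rewrite !amulE.
    by rewrite /F !amulE xy IHn -(amulA (u n) x) IHn !amulA.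
  apply: (@cvg_nm_unique _ _ (fun n => x ** u n)).
    by apply: cvg_nmM us; exact: cvg_nm_cst.
  rewrite (_ : (fun n => _) = (fun n => u n ** x)); last exact/funext.
  by apply: cvg_nmM => //; exact: cvg_nm_cst.
Qed.

(** For [z = x + i y] the right-hand side is the norm of [z^# z], by commutation, and [x] is the
    mean of [z] and [z^#]. *)
Lemma anorm_sqr_le_sum x y : x^# = x -> y^# = y -> x ** y = y ** x ->
  nm x ^+ 2 <= nm (x ** x + y ** y).
Proof.
move=> xsa ysa xy; pose z := x + 'i%C *: y.
have zz : z^# ** z = x ** x + y ** y.
  rewrite /z !astarE xsa ysa !amulE xy.
  have -> : 'i%C^* = - 'i%C :> R[i] by apply/eqP; rewrite eq_complex /= oppr0 !eqxx.
  rewrite !scaleNr scalerA.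
  have -> : 'i%C * 'i%C = -1 :> R[i] by rewrite -expr2 sqr_i.
  by lmod.
rewrite -zz anorm_sqr lerXn2r ?nnegrE ?anorm_ge0 //.
have -> : x = 2^-1%:C *: (z + z^#).
  rewrite /z !astarE xsa ysa.
  have -> : 'i%C^* = - 'i%C :> R[i] by apply/eqP; rewrite eq_complex /= oppr0 !eqxx.
  rewrite -{1}(scale1r x).
  have <- : 2^-1%:C + 2^-1%:C = 1 :> R[i].
    by apply/eqP; rewrite eq_complex /= addr0 eqxx andbT; apply/eqP; field.
  by lmod.
rewrite anormZr ger0_norm ?invr_ge0 // (le_trans (ler_wpM2l _ (anormD _ _))) ?invr_ge0 //.
by rewrite anorm_star; lra.
Qed.

End fixed_points.

(** If [b < a], the powers of [a / b] are unbounded by Bernoulli's inequality. This removes the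
    constant from an estimate known on all iterated squares. *)
Lemma ler_pow2n_bound (R : realType) (a b k : R) : 0 <= a -> 0 <= b ->
  (forall n, a ^+ (2 ^ n) <= k * b ^+ (2 ^ n)) -> a <= b.
Proof.
move=> a0; rewrite le_eqVlt => /predU1P[<-|b0] le_ab.
  by have := le_ab 0; rewrite expn0 !expr1 mulr0.
rewrite leNgt; apply/negP => lt_ba; pose d := a / b - 1.
have d0 : 0 < d by rewrite subr_gt0 ltr_pdivlMr // mul1r.
have bernoulli n : 1 + n%:R * d <= (1 + d) ^+ n.
  elim: n => [|n IHn]; first by rewrite expr0 mul0r addr0.
  have n0 : 0 <= n%:R * d by rewrite mulr_ge0 // ltW.
  rewrite exprS; apply: le_trans (ler_wpM2l _ IHn); last by rewrite addr_ge0 ?ltW.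
  by rewrite -natr1; nra.
have le_k n : n%:R * d <= k.
  apply: le_trans (_ : (2 ^ n)%:R * d <= _).
    by rewrite ler_pM2r // ler_nat ltnW // ltn_expl.
  apply: (@le_trans _ _ ((1 + d) ^+ (2 ^ n))).
    by rewrite (le_trans _ (bernoulli _)) // lerDr.
  have -> : 1 + d = a / b by rewrite /d addrC subrK.
  by rewrite expr_div_n ler_pdivrMr ?exprn_gt0.
have := le_k (Num.truncn (k / d)).+1; rewrite leNgt => /negP; apply.
by rewrite -ltr_pdivrMr // truncnS_gt.
Qed.

Section contractive.
Variables (R : realType) (A B : calg R).

Definition calg_hom (phi : A -> B) :=
  [/\ forall (a : R[i]) x y, phi (a *: x + y) = a *: phi x + phi y,
      forall x y, phi (x ** y) = phi x ** phi y
    & forall x, phi x^# = (phi x)^#].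

Variables (phi : A -> B) (phiH : calg_hom phi).

Lemma calg_hom0 : phi 0 = 0.
Proof.
by case: phiH => L _ _; have := L (-1) 0 0; rewrite scaler0 addr0 scaleN1r addNr.
Qed.

Lemma calg_homZ a x : phi (a *: x) = a *: phi x.
Proof. by case: (phiH) => L _ _; have := L a x 0; rewrite calg_hom0 !addr0. Qed.

Lemma calg_homD x y : phi (x + y) = phi x + phi y.
Proof. by case: (phiH) => L _ _; have := L 1 x y; rewrite !scale1r. Qed.

Lemma calg_homN x : phi (- x) = - phi x.
Proof. by rewrite -scaleN1r calg_homZ scaleN1r. Qed.

Lemma calg_homB x y : phi (x - y) = phi x - phi y.
Proof. by rewrite calg_homD calg_homN. Qed.

Lemma calg_homM x y : phi (x ** y) = phi x ** phi y.
Proof. by case: phiH. Qed.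

Lemma calg_hom_star x : phi x^# = (phi x)^#.
Proof. by case: phiH. Qed.

Definition calg_homE := (calg_homD, calg_homN, calg_homZ, calg_homM, calg_hom_star).

(* With [s = 1 - sqrt (1 - x ^ 2)] one has [2 s = x ^ 2 + s ^ 2], an algebraic
   identity preserved by [phi] which bounds [phi s], and then [phi x]. *)
Lemma calg_hom_bounded x : x^# = x -> nm x <= 1 -> nm (phi x) <= 2.
Proof.
move=> xsa x1; have [||s [ssa s1 sE sC]] := @exists_one_minus_sqrt _ _ (x ** x).
- by rewrite astarM xsa.
- by rewrite anorm_sqr_sa // expr_le1 // anorm_ge0.
have pE : 2%:R *: phi s = phi x ** phi x + phi s ** phi s.
  by rewrite -!calg_homM -calg_homD -sE calg_homZ.
have psa : (phi s)^# = phi s by rewrite -calg_hom_star ssa.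
have pxsa : (phi x)^# = phi x by rewrite -calg_hom_star xsa.
have pC : phi x ** phi s = phi s ** phi x.
  by rewrite -!calg_homM sC // amulA.
have nE : nm (2%:R *: phi s) = 2 * nm (phi s).
  by rewrite -[2%:R](rmorph_nat (real_complex R) 2) anormZr ger0_norm.
have := anorm_sqr_le_sum pxsa psa pC.
have := anorm_sqr_le_sum psa pxsa (esym pC).
rewrite [phi s ** _ + _]addrC -pE nE.
move: (nm (phi s)) (nm (phi x)) (anorm_ge0 (phi s)) (anorm_ge0 (phi x)) => b a b0 a0.
move=> bb aa; have b2 : b <= 2 by rewrite leNgt; apply/negP; nra.
by rewrite leNgt; apply/negP; nra.
Qed.

(** The C*-identity reduces to self-adjoint [y]. There, in both algebras, the norm of an iterated
    square is the same power of the norm, so the bound by 2 on the unit ball loses its constant in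
    the limit. *)
Lemma calg_hom_le x : nm (phi x) <= nm x.
Proof.
suff le_sa y : y^# = y -> nm (phi y) <= nm y.
  rewrite -(@ler_pXn2r _ 2) ?nnegrE ?anorm_ge0 // -!anorm_sqr.
  by rewrite -calg_hom_star -calg_homM le_sa // astarM astarK.
move=> ysa; apply: (@ler_pow2n_bound _ _ _ 2); rewrite ?anorm_ge0 // => n.
pose sq n := iter n (fun z : A => z ** z) y.
have sqS m : sq m.+1 = sq m ** sq m by [].
have sq_sa m : (sq m)^# = sq m.
  by elim: m => [|m IHm]; [exact: ysa|rewrite sqS astarM IHm].
have nm_sq m : nm (sq m) = nm y ^+ (2 ^ m).
  elim: m => [|m IHm]; first by rewrite expn0 expr1.
  by rewrite sqS anorm_sqr_sa // IHm -exprM expnSr.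
have nm_phi m : nm (phi (sq m)) = nm (phi y) ^+ (2 ^ m).
  elim: m => [|m IHm]; first by rewrite expn0 expr1.
  rewrite sqS calg_homM anorm_sqr_sa; last by rewrite -calg_hom_star sq_sa.
  by rewrite IHm -exprM expnSr.
rewrite -nm_phi -nm_sq; move: (sq n) (sq_sa n) => z zsa.
have := anorm_ge0 z; rewrite le_eqVlt => /predU1P[z0|z0].
  by rewrite (anorm_eq0 (esym z0)) calg_hom0 !anorm0 mulr0.
have := @calg_hom_bounded ((nm z)^-1%:C *: z); rewrite calg_homZ !anormZr astarZr zsa.
rewrite ger0_norm ?invr_ge0 ?anorm_ge0 // mulVf ?gt_eqF // => /(_ erefl (lexx _)).
by rewrite mulrC ler_pdivrMr.
Qed.

End contractive.

(** * The positive cone of a unital algebra *)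

Section unital.
Variables (R : realType) (U : calg R) (e : U).
Hypotheses (el : forall x : U, e ** x = x) (er : forall x : U, x ** e = x).
Implicit Types (x y p q : U) (r t : R).

Lemma unit_star : e^# = e.
Proof. by rewrite -[LHS]el -[RHS]astarK -[in RHS](el e^#) astarM astarK. Qed.

(** The C*-identity gives [|e| = |e|^2]; the value 0 remains possible because the algebra may be
    zero. *)
Lemma unit_norm_le1 : nm e <= 1.
Proof.
have := anorm_sqr e; rewrite unit_star el; have := anorm_ge0 e; nra.
Qed.

(** Spectrum-free form of [p >= 0]: self-adjoint with spectrum in [[0, 2 t]]. Closure under sums
    becomes the triangle inequality, and positivity of [x^# x] becomes the hard fact. *)
Definition positive p := p^# = p /\ exists2 t, 0 < t & nm (t%:C *: e - p) <= t.

Lemma positiveD p q : positive p -> positive q -> positive (p + q).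
Proof.
move=> [psa [t t0 pt]] [qsa [s s0 qs]]; split; first by rewrite astarD psa qsa.
exists (t + s); first exact: addr_gt0.
by rewrite rmorphD scalerDl opprD addrACA (le_trans (anormD _ _)) // lerD.
Qed.

Lemma positiveZ r p : 0 < r -> positive p -> positive (r%:C *: p).
Proof.
move=> r0 [psa [t t0 pt]]; split; first by rewrite astarZr psa.
exists (r * t); first exact: mulr_gt0.
by rewrite rmorphM -scalerA -scalerBr anormZr gtr0_norm // ler_pM2l.
Qed.

Lemma positive_norm_sub p r : p^# = p -> nm p <= r -> positive (r%:C *: e - p).
Proof.
move=> psa pr; split; first by rewrite astarB astarZr unit_star psa.
(* With [r + 1] the witness stays positive even when [r = 0]. *)
exists (r + 1); first by rewrite (le_lt_trans (le_trans (anorm_ge0 _) pr)) // ltrDl.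
have -> : (r + 1)%:C *: e - (r%:C *: e - p) = e + p.
  by rewrite rmorphD; lmod.
by rewrite addrC (le_trans (anormD _ _)) // lerD // unit_norm_le1.
Qed.

(** With [v = e - s], which is [sqrt (1 - x^2)], the claim reads [|v|^2 <= |v^2 + x^2| = |e|]. *)
Lemma anorm_one_sub_sqr x : x^# = x -> nm x <= 1 -> nm (e - x ** x) <= 1.
Proof.
move=> xsa x1; have [||s [ssa s1 sE sC]] := @exists_one_minus_sqrt _ _ (x ** x).
- by rewrite astarM xsa.
- by rewrite anorm_sqr_sa // expr_le1 // anorm_ge0.
pose v := e - s.
have vsa : v^# = v by rewrite astarB unit_star ssa.
have vv : v ** v = e - x ** x.
  have -> : x ** x = 2%:R *: s - s ** s by rewrite sE addrK.
  by rewrite !amulE !el !er; lmod.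
have vx : v ** x = x ** v by rewrite amulBl amulBr el er sC // amulA.
have := anorm_sqr_le_sum vsa xsa vx.
rewrite -anorm_sqr_sa // vv subrK => /le_trans; apply; exact: unit_norm_le1.
Qed.

Lemma anorm_shift_sqr x t : x^# = x -> 0 < t -> nm x ^+ 2 <= t ->
  nm (t%:C *: e - x ** x) <= t.
Proof.
move=> xsa t0 xt; pose c := (Num.sqrt t)^-1.
have c0 : 0 < c by rewrite invr_gt0 sqrtr_gt0.
have cc : c * c * t = 1.
  by rewrite -[X in _ * X](sqr_sqrtr (ltW t0)) /c; field; rewrite sqrtr_eq0 -ltNge.
have := @anorm_one_sub_sqr (c%:C *: x).
rewrite astarZr xsa anormZr gtr0_norm // => /(_ erefl).
have -> : c * nm x <= 1.
  rewrite -(@ler_pXn2r _ 2) ?nnegrE ?mulr_ge0 ?anorm_ge0 ?(ltW c0) //.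
  by rewrite expr1n exprMn -cc expr2 ler_pM2l // mulr_gt0.
move=> /(_ isT) le1.
have -> : t%:C *: e - x ** x = t%:C *: (e - (c%:C *: x) ** (c%:C *: x)).
  by rewrite amulZl amulZr scalerBr !scalerA -!rmorphM mulrC cc rmorph1 scale1r.
by rewrite anormZr gtr0_norm // ler_piMr // ltW.
Qed.

Lemma positive_sqr x : x^# = x -> positive (x ** x).
Proof.
move=> xsa; split; first by rewrite astarM xsa.
have t0 : 0 < nm x ^+ 2 + 1 by rewrite ltr_wpDl // sqr_ge0.
by exists (nm x ^+ 2 + 1) => //; apply: anorm_shift_sqr => //; rewrite lerDl.
Qed.

(** Write [p = t (1 - y)] with [|y| <= 1]; the root is [sqrt t] times the root [e - s] of [1 - y].
    The commutation clause does the work of functional calculus later on. *)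
Lemma positive_sqrt p : positive p ->
  exists x, [/\ positive x, x ** x = p
    & forall y, y ** p = p ** y -> y ** x = x ** y].
Proof.
move=> [psa [t t0 pt]]; pose y := e - t^-1%:C *: p.
have yE : t%:C *: y = t%:C *: e - p.
  rewrite /y scalerBr scalerA -rmorphM divff ?gt_eqF // scale1r //.
have y1 : nm y <= 1.
  rewrite -(ler_pM2l t0) mulr1 -{1}(gtr0_norm t0) -anormZr yE //.
have ysa : y^# = y by rewrite astarB unit_star astarZr psa.
have [s [ssa s1 sE sC]] := exists_one_minus_sqrt ysa y1.
pose x := (Num.sqrt t)%:C *: (e - s).
have st : Num.sqrt t * Num.sqrt t = t by rewrite -expr2 sqr_sqrtr // ltW.
exists x; split.
- apply: positiveZ; first by rewrite sqrtr_gt0.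
  by split; [rewrite astarB unit_star ssa|exists 1 => //; rewrite scale1r opprB addrC subrK].
- rewrite /x amulZl amulZr scalerA -rmorphM st !amulE !el !er.
  have -> : s ** s = 2%:R *: s - y by rewrite sE addrC addKr.
  apply: (@etrans _ _ (t%:C *: e - t%:C *: y)); first by lmod.
  by rewrite yE opprB addrC subrK.
- move=> z zp; have zs : z ** s = s ** z.
    by apply: sC; rewrite /y amulBl amulBr el er amulZl amulZr zp.
  by rewrite /x !amulE el er zs.
Qed.

(** By the commutation clause of [positive_sqrt] the square roots commute, so the product is the
    square of a self-adjoint element. *)
Lemma positiveM p q : positive p -> positive q -> p ** q = q ** p -> positive (p ** q).
Proof.
move=> /positive_sqrt[x [[xsa _] <- xC]] /positive_sqrt[y [[ysa _] <- yC]] pq.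
have /yC xy : x ** (y ** y) = y ** y ** x by rewrite (xC (y ** y)) // pq.
have -> : x ** x ** (y ** y) = (x ** y) ** (x ** y).
  by rewrite !amulA -(amulA x y x) -xy amulA.
by apply: positive_sqr; rewrite astarM xsa ysa xy.
Qed.

(** The elements [d = 2 p - r] and [2 w], with [w = sqrt (p (r - p))], commute and satisfy
    [d^2 + (2 w)^2 = r^2]. Hence [|2 p - r| <= r]. *)
Lemma positive_between_norm p r : 0 <= r -> positive p ->
  positive (r%:C *: e - p) -> nm p <= r.
Proof.
move=> r0 pp qq; have [psa _] := pp; set q := _ - p in qq.
have pq : p ** q = q ** p by rewrite !amulE el er.
have [w [[wsa _] wE wC]] := positive_sqrt (positiveM pp qq pq).
pose d := 2%:R *: p - r%:C *: e.
have dsa : d^# = d by rewrite /d !astarE conjc_nat conjc_real unit_star psa.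
have wd : w ** (2%:R *: w) = 2%:R *: (w ** w) by rewrite amulZr.
pose w2 := (2:R)%:C *: w.
have w2sa : w2^# = w2 by rewrite astarZr wsa.
have dw : d ** w2 = w2 ** d.
  rewrite /w2 amulZl amulZr wC //; rewrite /d /q.
  by rewrite !amulE !el !er; lmod.
have ww : w2 ** w2 = 4%:R *: (p ** q).
  by rewrite /w2 amulZl amulZr wE rmorph_nat; lmod.
have := anorm_sqr_le_sum dsa w2sa dw.
have -> : d ** d + w2 ** w2 = (r * r)%:C *: e.
  by rewrite ww /d /q !amulE !el !er rmorphM; lmod.
rewrite anormZr ger0_norm ?mulr_ge0 // => /le_trans/(_ (ler_wpM2l _ unit_norm_le1)).
rewrite mulr1 mulr_ge0 // -expr2 => /(_ isT).
rewrite ler_pXn2r ?nnegrE ?anorm_ge0 // => le_dr.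
have pE : (2:R)%:C *: p = d + r%:C *: e by rewrite rmorph_nat subrK.
have := anormD d (r%:C *: e); rewrite -pE !anormZr !ger0_norm //.
have := ler_wpM2l r0 unit_norm_le1; lra.
Qed.

Lemma positive_le_norm p q : positive p -> positive (q - p) -> nm p <= nm q.
Proof.
move=> pp qp; have [psa _] := pp.
have qsa : q^# = q.
  have [] := qp; rewrite astarB psa => /addIr //.
apply: positive_between_norm => //; first exact: anorm_ge0.
have -> : (nm q)%:C *: e - p = ((nm q)%:C *: e - q) + (q - p) by rewrite addrA subrK.
by apply: positiveD => //; exact: positive_norm_sub.
Qed.

End unital.

Section star_square_positive.
Variables (R : realType) (U : calg R) (e : U).
Hypotheses (el : forall x : U, e ** x = x) (er : forall x : U, x ** e = x).
Implicit Types (x y p q : U) (r t : R).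
Local Notation positive := (positive e).

(** Twice the element is [a^2 + b^2], where [a = y + y^#] and [b = i (y - y^#)] are self-adjoint. *)
Lemma add_star_squares_positive y : positive (y ** y^# + y^# ** y).
Proof.
pose a := y + y^#; pose b := 'i%C *: (y - y^#).
have i_conj : 'i%C^* = - 'i%C :> R[i].
  by apply/eqP; rewrite eq_complex /= oppr0 !eqxx.
have asa : a^# = a by rewrite /a astarD astarK addrC.
have bsa : b^# = b by rewrite /b astarZ astarB astarK i_conj; lmod.
have := positiveD (positive_sqr el er asa) (positive_sqr el er bsa).
have -> : b ** b = - ((y - y^#) ** (y - y^#)).
  by rewrite amulZl amulZr scalerA -expr2 sqr_i scaleN1r.
have -> : a ** a - (y - y^#) ** (y - y^#) = (2:R)%:C *: (y ** y^# + y^# ** y).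
  by rewrite rmorph_nat !amulE; lmod.
have i2 : 0 < 2^-1 :> R by rewrite invr_gt0.
move/(positiveZ i2); rewrite scalerA -rmorphM mulVf ?pnatr_eq0 // rmorph1 scale1r.
by [].
Qed.

(* For [m = - y^* y >= 0] and [l = y y^*] one has [(t - l) y = y (t + m)]. As
   [l >= 0], the left-hand side is bounded by [t |y|] for some [t], whereas
   the square norm [|m (t + m) ^ 2|] of the right-hand side exceeds [t ^ 2 |m|]
   unless [m = 0]. *)
Lemma star_square_neg y : positive (- (y^# ** y)) -> y = 0.
Proof.
set m := - _ => pm; have [msa _] := pm.
pose l := y ** y^#; have [_ [t t0 lt]] : positive l.
  have -> : l = (y ** y^# + y^# ** y) + m by rewrite addrK.
  exact: positiveD (add_star_squares_positive y) pm.
have yy : y^# ** y = - m by rewrite opprK.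
have nmm : nm m = nm y ^+ 2 by rewrite -anorm_sqr yy anormN.
pose Y := (t%:C *: e - l) ** y.
have YE : Y = y ** (t%:C *: e + m) by rewrite /Y /l /m !amulE el er; lmod.
pose X := (t * t)%:C *: m + (t%:C *: (2%:R *: (m ** m)) + m ** m ** m).
have nX : nm X <= t ^+ 2 * nm m.
  have -> : X = - (Y^# ** Y).
    rewrite {1}YE YE astarM astarD astarZr (unit_star el) msa.
    by rewrite /X /m !amulE !el !er rmorphM; lmod.
  rewrite anormN anorm_sqr nmm -exprMn ler_pXn2r ?nnegrE ?mulr_ge0 ?anorm_ge0 ?(ltW t0) //.
  by rewrite (le_trans (anormM _ _)) // ler_wpM2r ?anorm_ge0.
have [m_gt0|m_le0] := ltrP 0 (nm m); last first.
  apply: anorm_eq0; apply/eqP; rewrite -sqrf_eq0 -nmm eq_le m_le0; exact: anorm_ge0.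
(* Here [X] is [m (t + m)^2]. As [m <= |m|], the term [t^2 m] dominates [(t^2 / |m|) m^2]; together
   with [2 t m^2] this makes [X - k m^2] positive, and [k |m|^2] exceeds [t^2 |m|] by
   [2 t |m|^2]. *)
pose k := t ^+ 2 / nm m + 2 * t.
have k0 : 0 < k by rewrite addr_gt0 ?divr_gt0 ?exprn_gt0 ?mulr_gt0.
have pm2 : positive (m ** m) by apply: positiveM.
have pm3 : positive (m ** m ** m) by apply: positiveM => //; rewrite amulA.
have pmm : positive (m ** ((nm m)%:C *: e - m)).
  apply: positiveM => //; last by rewrite amulBr amulBl amulZl amulZr el er.
  exact: positive_norm_sub.
have c0 : 0 < t ^+ 2 / nm m by rewrite divr_gt0 ?exprn_gt0.
have := @positive_le_norm _ _ _ el er (k%:C *: (m ** m)) X.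
have -> : X - k%:C *: (m ** m) =
    (t ^+ 2 / nm m)%:C *: (m ** ((nm m)%:C *: e - m)) + m ** m ** m.
  rewrite amulBr amulZr er scalerBr scalerA -rmorphM divfK ?gt_eqF // /X /k.
  by rewrite rmorphD (rmorphM _ 2) rmorph_nat expr2; lmod.
move=> /(_ (positiveZ k0 pm2) (positiveD (positiveZ c0 pmm) pm3)) /le_trans/(_ nX).
rewrite anormZr gtr0_norm // anorm_sqr_sa // /k mulrDl expr2 mulrA divfK ?gt_eqF //.
by rewrite -subr_ge0 -expr2 opprD addrA subrr add0r oppr_ge0 leNgt ?mulr_gt0 ?exprn_gt0.
Qed.

Lemma sqr_sa_eq0 x : x^# = x -> x ** x = 0 -> x = 0.
Proof.
move=> xsa xx; apply: anorm_eq0; apply/eqP; rewrite -sqrf_eq0 -anorm_sqr_sa //.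
by rewrite xx anorm0.
Qed.

(* With [h = x^* x], [b = |h|] and [c = b - h], the element [y = x c] satisfies
   [y^* y = - c b c <= 0], hence [c = 0]. *)
Lemma positive_star_square x : positive (x^# ** x).
Proof.
set h := _ ** x; have hsa : h^# = h by rewrite astarM astarK.
have hE : x^# ** x = h by []; clearbody h.
have [b [pb bb bC]] := positive_sqrt el er (positive_sqr el er hsa).
have [bsa _] := pb.
(* The root [g] of [b] writes [c b c] as the square of the self-adjoint element [c g]. *)
have [g [[gsa _] gg gC]] := positive_sqrt el er pb.
have hb : h ** b = b ** h by apply: bC; rewrite amulA.
pose c := b - h; have csa : c^# = c by rewrite astarB bsa hsa.
have bc : b ** c = c ** b by rewrite /c amulBl amulBr hb.
have cg : c ** g = g ** c by apply: gC.
have cbh : c ** (b + h) = 0 by rewrite /c !amulE bb hb; lmod.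
have ch : c ** h = - (c ** b) by apply/eqP; rewrite -addr_eq0 -amulDr addrC cbh.
have cgsa : (c ** g)^# = c ** g by rewrite astarM csa gsa cg.
have xcE : - ((x ** c)^# ** (x ** c)) = (c ** g) ** (c ** g).
  rewrite astarM csa -(amulA c) (amulA x^#) hE amulA ch amulNl opprK.
  by rewrite -gg amulA -(amulA (c ** g)) -cg.
have xc0 : x ** c = 0 by apply: star_square_neg; rewrite xcE; exact: positive_sqr.
have cg0 : c ** g = 0.
  by apply: sqr_sa_eq0 => //; rewrite -xcE xc0 amul0r oppr0.
have cb0 : c ** b = 0 by rewrite -gg amulA cg0 amul0l.
have c0 : c = 0.
  by apply: sqr_sa_eq0 => //; rewrite {2}/c amulBr ch cb0 oppr0 subr0.
by have /eqP := c0; rewrite subr_eq0 => /eqP <-.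
Qed.

End star_square_positive.

(** * Operator norms and the modulus of complex numbers *)

Section operator_norm.
Variables (R : realType) (V : lmodType R[i]) (D : set V) (p f : V -> R).
Hypotheses (D0 : D 0) (DZ : forall r x, D x -> D (r%:C *: x)).
Hypotheses (p_ge0 : forall x, 0 <= p x).
Hypotheses (pZ : forall r x, D x -> p (r%:C *: x) = `|r| * p x).
Hypotheses (f_ge0 : forall x, 0 <= f x).
Hypotheses (fZ : forall r x, D x -> f (r%:C *: x) = `|r| * f x).

(** Shared by unitizations, matrix algebras and crossed products: [reduced_norm] is convertible to
    the instance with [D = Cc], whence the restriction to a subset and the weak axioms on [p] and
    [f]. *)
Definition opnorm := sup [set f x | x in [set x | D x /\ p x <= 1]].

Let opset_neq0 : [set f x | x in [set x | D x /\ p x <= 1]] !=set0.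
Proof.
by exists (f 0), 0 => //; split=> //; have := pZ 0 D0; rewrite scale0r normr0 mul0r => ->.
Qed.

Lemma opnorm_le c : 0 <= c -> (forall x, D x -> f x <= c * p x) -> opnorm <= c.
Proof.
move=> c0 fc; apply: ge_sup => // _ [x [Dx px] <-].
by rewrite (le_trans (fc x Dx)) // ler_piMr.
Qed.

Variables (c : R) (fc : forall x, D x -> f x <= c * p x).

Let opset_has_sup : has_sup [set f x | x in [set x | D x /\ p x <= 1]].
Proof.
split=> //; exists (Num.max c 0) => _ [x [Dx px] <-].
rewrite (le_trans (fc Dx)) // (@le_trans _ _ (Num.max c 0 * p x)) //.
  by rewrite ler_wpM2r // le_max lexx.
by rewrite ler_piMr // le_max lexx orbT.
Qed.

Lemma opnorm_ge0 : 0 <= opnorm.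
Proof.
apply: (@le_trans _ _ (f 0)) => //; apply: ub_le_sup; first by case: opset_has_sup.
by exists 0 => //; split=> //; have := pZ 0 D0; rewrite scale0r normr0 mul0r => ->.
Qed.

Lemma opnorm_ub x : D x -> f x <= opnorm * p x.
Proof.
(* When [p x] vanishes [x] cannot be normalized, but the a priori bound [c] then makes [f x]
   nonpositive. *)
move=> Dx; have := p_ge0 x; rewrite le_eqVlt => /predU1P[px|px].
  by rewrite -px mulr0 (le_trans (fc Dx)) // -px mulr0.
rewrite -ler_pdivrMr // mulrC -[(p x)^-1]gtr0_norm ?invr_gt0 // -fZ //.
apply: ub_le_sup; first by case: opset_has_sup.
exists ((p x)^-1%:C *: x) => //; split; first exact: DZ.
by rewrite pZ // gtr0_norm ?invr_gt0 // mulVf // gt_eqF.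
Qed.

End operator_norm.

Section complex_modulus.
Variable R : realType.
Implicit Types (a b : R[i]).

Definition cabs a : R := complex.Re `|a|.

Lemma cabsE a : (cabs a)%:C = `|a|.
Proof. by rewrite /cabs normc_def. Qed.
Lemma cabs_ge0 a : 0 <= cabs a.
Proof. by rewrite -ler0c cabsE. Qed.
Lemma cabsD a b : cabs (a + b) <= cabs a + cabs b.
Proof. by rewrite -lecR rmorphD /= !cabsE ler_normD. Qed.
Lemma cabsM a b : cabs (a * b) = cabs a * cabs b.
Proof. by apply: complexI; rewrite rmorphM /= !cabsE normrM. Qed.
Lemma cabs_conj a : cabs a^*%C = cabs a.
Proof. by apply: complexI; rewrite !cabsE normcJ. Qed.
Lemma cabs_eq0 a : cabs a = 0 -> a = 0.
Proof. by move=> a0; apply/normr0_eq0; rewrite -cabsE a0. Qed.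
Lemma cabs_real (r : R) : cabs r%:C = `|r|.
Proof. by rewrite /cabs normc_def /= expr0n addr0 sqrtr_sqr. Qed.
Lemma cabs0 : cabs 0 = 0.
Proof. by rewrite (cabs_real 0) normr0. Qed.
Lemma cabs_Re a : `|complex.Re a| <= cabs a.
Proof. by rewrite -lecR cabsE normc_ge_Re. Qed.
Lemma cabs_Im a : `|complex.Im a| <= cabs a.
Proof.
rewrite /cabs normc_def /= -[leLHS](sqrtr_sqr (complex.Im a)).
by rewrite ler_wsqrtr // lerDr sqr_ge0.
Qed.
Lemma cabs_le a : cabs a <= `|complex.Re a| + `|complex.Im a|.
Proof.
rewrite {1}[a]complexE (le_trans (cabsD _ _)) // cabsM !cabs_real.
by rewrite /cabs normc_def /= expr0n expr1n add0r sqrtr1 mul1r.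
Qed.

Lemma seq_cauchy_cvgn (u : nat -> R) : seq_cauchy (fun x => `|x|) u -> cvgn u.
Proof.
move=> cu; suff : cauchy (u n @[n --> \oo]) by move=> /cauchy_cvgP.
apply/cauchy_exP => eps eps0.
by have [N hN] := cu _ eps0; exists (u N), N => // n /= Nn; exact: hN.
Qed.

Lemma cabs_complete (u : nat -> R[i]) : seq_cauchy cabs u ->
  exists l, cabs (u n - l) @[n --> \oo] --> (0 : R).
Proof.
have ReB a b : complex.Re (a - b) = complex.Re a - complex.Re b by case: a b => [? ?] [].
have ImB a b : complex.Im (a - b) = complex.Im a - complex.Im b by case: a b => [? ?] [].
move=> cu; have /cvg_ex [r ur] : cvgn (fun n => complex.Re (u n)).
  apply: seq_cauchy_cvgn => eps /cu[N hN]; exists N => m n Nm Nn.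
  by apply: le_lt_trans (hN m n Nm Nn); rewrite -ReB cabs_Re.
have /cvg_ex [i ui] : cvgn (fun n => complex.Im (u n)).
  apply: seq_cauchy_cvgn => eps /cu[N hN]; exists N => m n Nm Nn.
  by apply: le_lt_trans (hN m n Nm Nn); rewrite -ImB cabs_Im.
exists (r +i* i).
apply: (@squeeze_cvgr _ _ _ _ (fun=> 0)
  (fun n => `|complex.Re (u n) - r| + `|complex.Im (u n) - i|)).
- apply: nearW => n; rewrite cabs_ge0 (le_trans (cabs_le _)) //.
  by rewrite ReB ImB.
- exact: cvg_cst.
- rewrite -(addr0 0); apply: cvgD.
    by rewrite -(normr0 R); apply: cvg_norm; rewrite -(subrr r); apply: cvgB => //; exact: cvg_cst.
  by rewrite -(normr0 R); apply: cvg_norm; rewrite -(subrr i); apply: cvgB => //; exact: cvg_cst.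
Qed.

End complex_modulus.

(** * Unitization *)

Section unitization.
Variables (R : realType) (A : calg R).
Let T : lmodType R[i] := (A * R[i]^o)%type.
Implicit Types (z w : T) (x y : A).

Definition ract z x : A := z.1 ** x + (z.2 : R[i]) *: x.
Definition ract_norm z : R := opnorm setT nm (fun x => nm (ract z x)).
(** If [A] has a unit, the pair of its opposite and the scalar 1 acts by zero, so the multiplier
    norm is only a seminorm. The maximum with the modulus of the scalar part, itself a C*-seminorm,
    makes it definite and changes nothing on [A]. *)
Definition unorm z : R := Num.max (ract_norm z) (cabs z.2).
Definition umul z w : T :=
  (z.1 ** w.1 + (z.2 : R[i]) *: w.1 + (w.2 : R[i]) *: z.1, (z.2 : R[i]) * w.2).
Definition ustar z : T := (z.1^#, (z.2 : R[i])^*%C).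

Lemma ract_bound z x : nm (ract z x) <= (nm z.1 + cabs z.2) * nm x.
Proof.
by rewrite (le_trans (anormD _ _)) // mulrDl lerD ?anormM // anormZ.
Qed.

Let ractZ z (r : R) x : nm (ract z (r%:C *: x)) = `|r| * nm (ract z x).
Proof.
have -> : ract z (r%:C *: x) = r%:C *: ract z x by rewrite /ract amulZr; lmod.
exact: anormZr.
Qed.

Lemma ract_norm_le z (c : R) : 0 <= c ->
  (forall x, nm (ract z x) <= c * nm x) -> ract_norm z <= c.
Proof.
by move=> c0 zc; apply: opnorm_le => // r x _; exact: anormZr.
Qed.

Lemma ract_norm_ub z x : nm (ract z x) <= ract_norm z * nm x.
Proof.
apply: (opnorm_ub (D := setT) I _ (@anorm_ge0 _ A) (fun r x _ => anormZr r x)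
  (fun r x _ => ractZ z r x) (c := nm z.1 + cabs z.2)) => //.
by move=> y _; exact: ract_bound.
Qed.

Lemma ract_norm_ge0 z : 0 <= ract_norm z.
Proof.
apply: (opnorm_ge0 (D := setT) I (@anorm_ge0 _ A) (fun r x _ => anormZr r x) _
  (c := nm z.1 + cabs z.2)) => //.
  by move=> y; exact: anorm_ge0.
by move=> y _; exact: ract_bound.
Qed.

Lemma ractM z w x : ract (umul z w) x = ract z (ract w x).
Proof. by rewrite /ract /= !amulE; lmod. Qed.

Lemma ractD z w x : ract (z + w) x = ract z x + ract w x.
Proof. by rewrite /ract /= !amulE; lmod. Qed.

Lemma ract_star_mul z x : (ract z x)^# ** ract z x = x^# ** ract (umul (ustar z) z) x.
Proof. by rewrite ractM /ract /= !astarE !amulE; lmod. Qed.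

(** Evaluation at [x^#] recovers the norm, as [|x x^#| = |x|^2]. *)
Lemma ract_norm_inl x : ract_norm (x, 0) = nm x.
Proof.
apply/eqP; rewrite eq_le; apply/andP; split.
  apply: ract_norm_le; first exact: anorm_ge0.
  by move=> y; rewrite /ract scale0r addr0 anormM.
have [/anorm_le0 ->|x0] := lerP (nm x) 0; first by rewrite anorm0 ract_norm_ge0.
rewrite -(ler_pM2r x0) -{3}anorm_star.
have := ract_norm_ub (x, 0) x^#; rewrite /ract scale0r addr0 /= => /(le_trans _); apply.
by rewrite -{3}(astarK x) anorm_sqr anorm_star expr2.
Qed.

Lemma ract_normD z w : ract_norm (z + w) <= ract_norm z + ract_norm w.
Proof.
apply: ract_norm_le => [|x]; first by rewrite addr_ge0 // ract_norm_ge0.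
by rewrite ractD (le_trans (anormD _ _)) // mulrDl lerD // ract_norm_ub.
Qed.

Lemma ract_normZ (a : R[i]) z : ract_norm (a *: z) = cabs a * ract_norm z.
Proof.
have le_aZ b w : ract_norm (b *: w) <= cabs b * ract_norm w.
  apply: ract_norm_le => [|x]; first by rewrite mulr_ge0 ?cabs_ge0 // ract_norm_ge0.
  have -> : ract (b *: w) x = b *: ract w x.
    by rewrite /ract /= !amulE scalerDr scalerA.
  by rewrite anormZ -mulrA ler_wpM2l ?cabs_ge0 // ract_norm_ub.
have [->|a0] := eqVneq a 0.
  by apply/eqP; rewrite eq_le le_aZ cabs0 mul0r ract_norm_ge0.
apply/eqP; rewrite eq_le le_aZ /=.
have ca0 : 0 < cabs a.
  by rewrite lt_neqAle cabs_ge0 andbT eq_sym; apply: contra_neq a0; exact: cabs_eq0.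
have := le_aZ a^-1 (a *: z); rewrite scalerA mulVf // scale1r.
have -> : cabs a^-1 = (cabs a)^-1.
  apply: (mulfI (lt0r_neq0 ca0)); rewrite -cabsM (divff a0) divff ?gt_eqF //.
  by rewrite -(rmorph1 (real_complex R)) cabs_real normr1.
by rewrite -(ler_pM2l ca0) mulrA divff ?gt_eqF // mul1r.
Qed.

Lemma ract_norm_star_mul z : ract_norm z ^+ 2 <= ract_norm (umul (ustar z) z).
Proof.
set w := umul _ _; have w0 := ract_norm_ge0 w.
rewrite -[leRHS]sqr_sqrtr // ler_pXn2r ?nnegrE ?ract_norm_ge0 ?sqrtr_ge0 //.
apply: ract_norm_le => [|x]; first exact: sqrtr_ge0.
rewrite -(@ler_pXn2r _ 2) ?nnegrE ?anorm_ge0 ?mulr_ge0 ?sqrtr_ge0 ?anorm_ge0 //.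
rewrite exprMn sqr_sqrtr // -anorm_sqr ract_star_mul (le_trans (anormM _ _)) //.
by rewrite anorm_star mulrC expr2 mulrA ler_wpM2r ?anorm_ge0 // ract_norm_ub.
Qed.

Definition unitization : calg R.
Proof.
refine (@CAlg R T umul ustar unorm _ _ _ _ _ _ _ _ _ _ _ _ _ _ _ _).
- move=> [x a] [y b] [z c]; congr pair => /=; last exact: mulrA.
  by rewrite !amulE; lmod.
- move=> [x a] [y b] [z c]; congr pair => /=; last exact: mulrDl.
  by rewrite !amulE; lmod.
- move=> [x a] [y b] [z c]; congr pair => /=; last exact: mulrDr.
  by rewrite !amulE; lmod.
- move=> k [x a] [y b]; congr pair => /=; last by rewrite -scalerAl.
  by have -> : k *: (a : R[i]^o) = k * a by []; rewrite !amulE; lmod.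
- move=> k [x a] [y b]; congr pair => /=; last exact: mulrCA.
  by have -> : k *: (b : R[i]^o) = k * b by []; rewrite !amulE; lmod.
- by move=> [x a] [y b]; congr pair; rewrite /= ?astarD ?rmorphD.
- by move=> k [x a]; congr pair; rewrite /= ?astarZ // rmorphM.
- move=> [x a] [y b]; congr pair => /=; last by rewrite rmorphM mulrC.
  by rewrite !astarE; lmod.
- by move=> [x a]; congr pair; rewrite /= ?astarK ?conjcK.
- by move=> z; rewrite le_max ract_norm_ge0.
- move=> [x a] z0; move: z0; rewrite /unorm => /eqP.
  rewrite eq_le ge_max => /andP[/andP[x0 a0] _].
  have a00 : a = 0 by apply: cabs_eq0; apply/eqP; rewrite eq_le a0 cabs_ge0.
  by move: x0; rewrite a00 ract_norm_inl => /anorm_le0 ->.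
- move=> z w; rewrite ge_max; apply/andP; split.
    by rewrite (le_trans (ract_normD _ _)) // lerD // le_max lexx.
  by rewrite (le_trans (cabsD _ _)) // lerD // le_max lexx orbT.
- by move=> k z; rewrite /unorm ract_normZ cabsM -maxr_pMr ?cabs_ge0.
- move=> z w; rewrite ge_max; apply/andP; split.
    apply: ract_norm_le => [|x]; first by rewrite mulr_ge0 // le_max ract_norm_ge0.
    rewrite ractM (le_trans (ract_norm_ub _ _)) // -mulrA ler_pM ?ract_norm_ge0 ?anorm_ge0 //.
      by rewrite le_max lexx.
    by rewrite (le_trans (ract_norm_ub _ _)) // ler_wpM2r ?anorm_ge0 // le_max lexx.
  by rewrite cabsM ler_pM ?cabs_ge0 // le_max lexx orbT.
- move=> z; rewrite /unorm; have [le_ra|lt_ar] := leP (ract_norm z) (cabs z.2).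
    by rewrite le_max [umul _ _]/umul /= cabsM cabs_conj expr2 lexx orbT.
  by rewrite le_max ract_norm_star_mul.
- move=> u cu.
  (* [(z.1, 0)] is [z - (0, z.2)], and both terms have multiplier norm at most [unorm z]; so the
     first components of a Cauchy sequence are Cauchy. *)
  have unit_ge z : nm z.1 <= 2 * unorm z.
    rewrite -ract_norm_inl.
    have -> : (z.1, 0) = z + (-1) *: ((0, z.2) : T).
      by case: z => x a; congr pair; rewrite /= ?scaler0 ?addr0 // scaleN1r subrr.
    rewrite (le_trans (ract_normD _ _)) // ract_normZ mulr_natl mulr2n lerD //.
      by rewrite le_max lexx.
    have -> : cabs (-1 : R[i]) = 1 by apply: complexI; rewrite cabsE normrN1.
    rewrite mul1r le_max; apply/orP; right; apply: ract_norm_le => [|x]; first exact: cabs_ge0.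
    by rewrite /ract /= amul0l add0r anormZ.
  have [l ul] : exists l, nm ((u n).1 - l) @[n --> \oo] --> (0 : R).
    apply: acomplete => eps eps0.
    have [N hN] := cu (eps / 2) (divr_gt0 eps0 (ltr0n _ 2)); exists N => m n Nm Nn.
    rewrite (le_lt_trans (unit_ge (u m - u n))) // mulrC -ltr_pdivlMr //; exact: hN.
  have [a ua] : exists a, cabs ((u n).2 - a) @[n --> \oo] --> (0 : R).
    apply: cabs_complete => eps /cu[N hN]; exists N => m n Nm Nn.
    by apply: le_lt_trans (hN m n Nm Nn); rewrite le_max lexx orbT.
  exists (l, a).
  apply: (@squeeze_cvgr _ _ _ _ (fun=> 0)
    (fun n => nm ((u n).1 - l) + cabs ((u n).2 - a))).
  + apply: nearW => n; rewrite le_max ract_norm_ge0 /= ge_max; apply/andP; split.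
      apply: ract_norm_le => [|x]; first by rewrite addr_ge0 ?anorm_ge0 ?cabs_ge0.
      exact: ract_bound.
    by rewrite lerDr anorm_ge0.
  + exact: cvg_cst.
  + by rewrite -(addr0 0); exact: cvgD.
Defined.

End unitization.

(** * Bounded lifts *)

(* The fields are all that is used of a unitization; sealing an instance below
   keeps its concrete norm out of conversion problems. *)
Record unital_extension (R : realType) (A : calg R) := UnitalExtension {
  uext : calg R;
  uone : uext;
  uinl : A -> uext;
  uone_mul : forall z, uone ** z = z;
  umul_one : forall z, z ** uone = z;
  uinl_hom : calg_hom uinl;
  uinl_norm : forall x, nm (uinl x) = nm x
}.

Lemma the_unital_extension (R : realType) (A : calg R) : unital_extension A.
Proof.
apply: (@UnitalExtension R A (unitization A) (0, 1) (fun x => (x, 0))).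
- move=> [x a]; congr pair => /=; last exact: mul1r.
  by rewrite amul0l scale1r scaler0 add0r addr0.
- move=> [x a]; congr pair => /=; last exact: mulr1.
  by rewrite amul0r scale1r scaler0 !add0r.
- split=> [a x y|x y|x]; congr pair => /=.
  + by rewrite scaler0 addr0.
  + by rewrite scale0r scale0r !addr0.
  + by rewrite mulr0.
  + exact/esym/conjc0.
- move=> x; rewrite /= /unorm ract_norm_inl /= cabs0.
  by apply/max_idPl; exact: anorm_ge0.
Qed.

Section nonunital_positivity.
Variables (R : realType) (A : calg R).
Implicit Types (x y z h p q u w : A) (r t : R).

Let E := the_unital_extension A.
Local Notation one := (uone E).
Local Notation inl := (@uinl _ _ E).
Local Notation one_mul := (@uone_mul _ _ E).
Local Notation mul_one := (@umul_one _ _ E).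
Local Notation inl_hom := (uinl_hom E).
Local Notation inl_norm := (uinl_norm E).

Definition apos p := positive one (inl p).

Lemma apos_star_square x : apos (x^# ** x).
Proof.
rewrite /apos (calg_homM inl_hom) (calg_hom_star inl_hom).
exact: positive_star_square one_mul mul_one _.
Qed.

Lemma aposD p q : apos p -> apos q -> apos (p + q).
Proof. by move=> pp pq; rewrite /apos (calg_homD inl_hom); exact: positiveD. Qed.

Lemma aposZ r p : 0 < r -> apos p -> apos (r%:C *: p).
Proof. by move=> r0 pp; rewrite /apos (calg_homZ inl_hom); exact: positiveZ. Qed.

Lemma apos0 : apos 0.
Proof. by have := apos_star_square 0; rewrite amul0r. Qed.

Lemma apos_sum (I : Type) (s : seq I) (P : pred I) (F : I -> A) :
  (forall i, P i -> apos (F i)) -> apos (\sum_(i <- s | P i) F i).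
Proof. by move=> F0; elim/big_ind: _ => //; [exact: apos0|exact: aposD]. Qed.

Lemma apos_le_norm p q : apos p -> apos (q - p) -> nm p <= nm q.
Proof.
move=> pp pq; rewrite -!inl_norm.
apply: (positive_le_norm one_mul mul_one pp).
by rewrite -(calg_homB inl_hom).
Qed.

(** With [x = sqrt (r - h)] in the unitization, the element is [(x y)^# (x y)]. *)
Lemma apos_conj_norm_sub h y r : h^# = h -> nm h <= r ->
  apos (r%:C *: (y^# ** y) - y^# ** h ** y).
Proof.
move=> hsa hr; have ihsa : (inl h)^# = inl h by rewrite -(calg_hom_star inl_hom) hsa.
have := @positive_norm_sub _ _ one one_mul (inl h) r ihsa.
rewrite inl_norm => /(_ hr)/(positive_sqrt one_mul mul_one)[x [[xsa _] xx _]].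
have := positive_star_square one_mul mul_one (x ** inl y).
rewrite astarM xsa -amulA (amulA x) xx /apos.
congr positive; rewrite (calg_homB inl_hom) (calg_homZ inl_hom) !(calg_homM inl_hom).
by rewrite (calg_hom_star inl_hom) !amulE mul_one.
Qed.

(** [t - h^2] lives in the unitization, but multiplication by it preserves [A]. The bound turns the
    equation [(1 + h^2) u = h] into a contraction problem. *)
Lemma anorm_sub_sqr_mul h x t : h^# = h -> 0 < t -> nm h ^+ 2 <= t ->
  nm (t%:C *: x - h ** h ** x) <= t * nm x.
Proof.
move=> hsa t0 ht; have ihsa : (inl h)^# = inl h by rewrite -(calg_hom_star inl_hom) hsa.
have := anorm_shift_sqr one_mul mul_one ihsa t0.
rewrite inl_norm => /(_ ht) le_t.
rewrite -!inl_norm (calg_homB inl_hom) (calg_homZ inl_hom) !(calg_homM inl_hom).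
rewrite -{1}(one_mul (inl x)) -amulZl -amulBl (le_trans (anormM _ _)) //.
by rewrite ler_wpM2r // anorm_ge0.
Qed.

(* [2 u] and [1 - 2 w] are the real and imaginary parts of a unitary. *)
Lemma anorm_le_half u w : u^# = u -> w^# = w -> u ** w = w ** u ->
  u ** u = w - w ** w -> nm u <= 2^-1.
Proof.
move=> usa wsa uw uu; pose U := (2:R)%:C *: inl u; pose W := one - (2:R)%:C *: inl w.
have Usa : U^# = U by rewrite astarZr -(calg_hom_star inl_hom) usa.
have Wsa : W^# = W.
  by rewrite astarB (unit_star one_mul) astarZr -(calg_hom_star inl_hom) wsa.
have UW : U ** W = W ** U.
  rewrite /U /W amulBr amulBl mul_one one_mul !amulZl !amulZr -!(calg_homM inl_hom).
  by rewrite uw.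
have := anorm_sqr_le_sum Usa Wsa UW.
have -> : U ** U + W ** W = one.
  rewrite /W amulBr !amulBl !mul_one one_mul.
  rewrite /U !amulZl !amulZr -!(calg_homM inl_hom) uu (calg_homB inl_hom).
  by rewrite !rmorph_nat; lmod.
move=> /le_trans/(_ (unit_norm_le1 one_mul)).
rewrite /U anormZr inl_norm ger0_norm // expr_le1 ?mulr_ge0 ?anorm_ge0 //; lra.
Qed.

End nonunital_positivity.

Section bounded_lift.
Variables (R : realType) (A B : calg R) (phi : A -> B) (phiH : calg_hom phi).
Implicit Types (x y h : A).

Lemma half_double (V : lmodType R[i]) (x : V) : 2^-1%:C *: (2%:R *: x) = x.
Proof.
by rewrite scalerA -(rmorph_nat (real_complex R)) -rmorphM mulVf ?pnatr_eq0 // rmorph1 scale1r.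
Qed.

(* The lift is [f h] for [f t = t] if [|t| <= 1] and [f t = 1 / t] otherwise:
   with [u = h / (1 + h ^ 2)], of norm at most [1 / 2], it is the solution [y] of
   [y = u + u y ^ 2] given by a convergent power series in [u]. *)
Lemma bounded_lift_sa h : h^# = h -> nm (phi h) < 1 ->
  exists y, phi y = phi h /\ nm y <= 1.
Proof.
move=> hsa ph1; pose t := nm h ^+ 2 + 1.
have t0 : 0 < t by rewrite ltr_wpDl // sqr_ge0.
have ht : nm h ^+ 2 <= t by rewrite lerDl.
have t1 : 0 < 1 + t by rewrite addr_gt0.
clearbody t.
have le_t z := anorm_sub_sqr_mul z hsa t0 ht.
have [u uE] : exists u, u + h ** h ** u = h.
  (* The equation [u + h^2 u = h] is equivalent to [(1 + t) u = h + (t - h^2) u], whose contraction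
     ratio is [t / (1 + t)]. *)
  pose T (z : A) := (1 + t)^-1%:C *: (t%:C *: z - h ** h ** z).
  have [|||u uT] := @additive_contraction_fixpoint _ A T (t / (1 + t)) ((1 + t)^-1%:C *: h).
  - by rewrite divr_ge0 ?ltW //= ltr_pdivrMr // mul1r ltrDr.
  - by move=> x y; rewrite /T !amulE; lmod.
  - move=> z; rewrite /T anormZr gtr0_norm ?invr_gt0 // [t / _]mulrC -mulrA.
    by rewrite ler_wpM2l // invr_ge0 ltW.
  exists u; have : (1 + t)%:C *: u = h + (t%:C *: u - h ** h ** u).
    rewrite [in LHS]uT /T -scalerDr scalerA -rmorphM divff ?gt_eqF // rmorph1 scale1r.
    by [].
  rewrite rmorphD rmorph1 scalerDl scale1r addrA.
  move=> /(congr1 (fun z => z - t%:C *: u + h ** h ** u)).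
  by rewrite addrK => ->; lmod.
(* [1 + h^2] is injective: on its kernel [t - h^2] acts as [1 + t], although its norm is at most
   [t]. Commutation of [u] with [h] and self-adjointness of [u] follow by uniqueness. *)
have inj z : z + h ** h ** z = 0 -> z = 0.
  move=> z0; apply: anorm_le0; have := le_t z.
  have -> : t%:C *: z - h ** h ** z = (1 + t)%:C *: z.
    by rewrite -[RHS]subr0 -z0 rmorphD rmorph1; lmod.
  by rewrite anormZr gtr0_norm // mulrDl mul1r gerDr.
have uh : u ** h = h ** u.
  apply/subr0_eq/inj.
  apply: (@etrans _ _ ((u + h ** h ** u) ** h - h ** (u + h ** h ** u))).
    by rewrite !amulE; lmod.
  by rewrite uE subrr.
have usa : u^# = u.
  apply/subr0_eq/inj.
  have uh' : u^# ** h = h ** u^# by have := congr1 (@astar _ A) uh; rewrite !astarM hsa.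
  have hhu : h ** h ** u^# = (h ** h ** u)^#.
    by rewrite !astarM hsa -amulA -uh' !amulA -uh'.
  rewrite amulBr hhu addrACA -astarD -opprD uE hsa subrr //.
pose w := u ** h.
have wsa : w^# = w by rewrite astarM hsa usa -uh.
have uw : u ** w = w ** u by rewrite /w -amulA -uh.
have uu : u ** u = w - w ** w.
  have hE : h - h ** u ** h = u by rewrite -amulA uh amulA -{1}uE addrK.
  by rewrite -{2}hE amulBr /w !amulA.
have u2 := anorm_le_half usa wsa uw uu.
pose u2' := (2:R)%:C *: u.
have u2sa : u2'^# = u2' by rewrite astarZr usa.
(* [s = 1 - sqrt (1 - 4 u^2)] plays the role of [2 u y] for the solution [y] of [y = u + u y^2]. The
   quadratic equation becomes the linear one [y = u + s y / 2], a contraction of ratio 1/2. *)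
have [||s [ssa s1 sE sC]] := @exists_one_minus_sqrt _ A (u2' ** u2').
- by rewrite astarM u2sa.
- rewrite anorm_sqr_sa // anormZr ger0_norm // expr_le1 ?mulr_ge0 ?anorm_ge0 //; lra.
have su : u ** s = s ** u by apply: sC; rewrite /u2' !amulE.
have sh : h ** s = s ** h.
  by apply: sC; rewrite /u2' !amulE -uh -(amulA u h) -uh amulA.
have TB (C : calg R) (v : C) : {morph (fun z => 2^-1%:C *: (v ** z)) : x y / x - y}.
  by move=> x y; rewrite amulBr scalerBr.
have Tq (C : calg R) (v z : C) : nm v <= 1 -> nm (2^-1%:C *: (v ** z)) <= 2^-1 * nm z.
  move=> v1; rewrite anormZr ger0_norm ?invr_ge0 // ler_wpM2l ?invr_ge0 //.
  by rewrite (le_trans (anormM _ _)) // ler_piMl ?anorm_ge0.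
have q1 : 0 <= (2^-1 : R) < 1 by rewrite invr_ge0 ler0n invf_lt1 // ltr1n.
have [y yE] := @additive_contraction_fixpoint _ A _ _ u q1 (TB A s) (fun z => Tq A s z s1).
exists y; split; last first.
  have := anormD u (2^-1%:C *: (s ** y)); rewrite -yE.
  have := Tq A s y s1; lra.
have ps1 : nm (phi s) <= 1 by rewrite (le_trans (calg_hom_le phiH s)).
have /andP[_ q1'] := q1.
(* Both [phi y] and [phi h] are shown to solve the image in [B] of this linear equation. *)
apply: (@additive_contraction_unique _ B _ _ (phi u) _ _ q1'
  (TB B (phi s)) (fun z => Tq B (phi s) z ps1)).
  by rewrite {1}yE !(calg_homE phiH).
pose H := phi h; pose U := phi u; pose S := phi s.
have UH : U ** H = H ** U by rewrite -!(calg_homM phiH) uh.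
have SH : H ** S = S ** H by rewrite -!(calg_homM phiH) sh.
have SU : U ** S = S ** U by rewrite -!(calg_homM phiH) su.
have HE : U + H ** H ** U = H by rewrite -!(calg_homM phiH) -(calg_homD phiH) uE.
have SE : 2%:R *: S = 4%:R *: (U ** U) + S ** S.
  rewrite /S -(calg_homZ phiH) sE /u2' !(calg_homE phiH) rmorph_nat amulZl amulZr.
  by rewrite -/U; lmod.
have UU : U ** U = U ** H - U ** H ** (U ** H).
  by rewrite -!(calg_homM phiH) -(calg_homB phiH) -uu.
(* Both [S] and [P = 2 U H] solve [2 P = 4 U^2 + P^2], so [2 (S - P) = (S + P) (S - P)]. As
   [|S| <= 1] and [|P| <= |H| < 1], the difference vanishes; this is where the strict bound on
   [phi h] enters. *)
have S2 : S = 2%:R *: (U ** H).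
  apply/subr0_eq/anorm_le0; set D := S - _.
  have DE : 2%:R *: D = (S + 2%:R *: (U ** H)) ** D.
    rewrite /D scalerBr SE UU !amulE -(amulA U H S) SH (amulA U) SU; lmod.
  have U2 : nm U <= 2^-1 by rewrite (le_trans (calg_hom_le phiH _)).
  have nUH : nm (2%:R *: (U ** H)) <= nm H.
    rewrite -(rmorph_nat (real_complex R)) anormZr ger0_norm //.
    have := anormM U H; have := ler_wpM2r (anorm_ge0 H) U2; lra.
  have := anormM (S + 2%:R *: (U ** H)) D.
  rewrite -DE -(rmorph_nat (real_complex R) 2) anormZr ger0_norm //.
  have lt2 : nm (S + 2%:R *: (U ** H)) < 2.
    by rewrite (le_lt_trans (anormD _ _)) //; move: ph1 ps1 nUH; rewrite -/H -/S; lra.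
  rewrite (rmorph_nat (real_complex R) 2).
  by rewrite -subr_ge0 -mulrBl nmulr_rge0 // subr_lt0.
rewrite -/H -/S S2 -{1}HE; congr (_ + _).
by rewrite amulZl half_double UH -!amulA UH.
Qed.

Lemma bounded_lift_sa_lt h (c : R) : h^# = h -> nm (phi h) < c ->
  exists y, phi y = phi h /\ nm y <= c.
Proof.
move=> hsa hc; have c0 : 0 < c := le_lt_trans (anorm_ge0 _) hc.
have [||y [yE y1]] := @bounded_lift_sa (c^-1%:C *: h).
- by rewrite astarZr hsa.
- by rewrite (calg_homZ phiH) anormZr gtr0_norm ?invr_gt0 // mulrC ltr_pdivrMr // mul1r.
exists (c%:C *: y); split; last by rewrite anormZr gtr0_norm // ger_pMr.
rewrite (calg_homZ phiH) yE (calg_homZ phiH) scalerA -rmorphM divff ?gt_eqF //.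
by rewrite rmorph1 scale1r.
Qed.

(** The real part [h] and the imaginary part [k] have images of norm at most that of [phi x];
    lifting them separately costs the factor 2. *)
Lemma bounded_lift x (c : R) : nm (phi x) < c ->
  exists y, phi y = phi x /\ nm y <= 2 * c.
Proof.
move=> xc.
have i_conj : 'i%C^* = - 'i%C :> R[i].
  by apply/eqP; rewrite eq_complex /= oppr0 !eqxx.
have ii : 'i%C * 'i%C = -1 :> R[i] by rewrite -expr2 sqr_i.
pose h := 2^-1%:C *: (x + x^#); pose k := 2^-1%:C *: ('i%C *: (x^# - x)).
have hsa : h^# = h by rewrite astarZr astarD astarK addrC.
have ksa : k^# = k by rewrite /k astarZr astarZ astarB astarK i_conj; lmod.
have xE : x = h + 'i%C *: k.
  have ci : 'i%C * 2^-1%:C * 'i%C = - 2^-1%:C :> R[i] by rewrite mulrAC ii mulN1r.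
  by rewrite /h /k !scalerA ci -[LHS]half_double; lmod.
have [y [yE yc]] : exists y, phi y = phi h /\ nm y <= c.
  apply: bounded_lift_sa_lt => //; apply: le_lt_trans xc.
  rewrite /h !(calg_homE phiH) anormZr ger0_norm ?invr_ge0 //.
  have := anormD (phi x) (phi x)^#; rewrite anorm_star; lra.
have [z [zE zc]] : exists y, phi y = phi k /\ nm y <= c.
  apply: bounded_lift_sa_lt => //; apply: le_lt_trans xc.
  rewrite /k !(calg_homE phiH) anormZr anormZi ger0_norm ?invr_ge0 //.
  have := anormB (phi x)^# (phi x); rewrite anorm_star; lra.
exists (y + 'i%C *: z); split.
  by rewrite [in RHS]xE !(calg_homD phiH) !(calg_homZ phiH _ k, calg_homZ phiH _ z) yE zE.
by rewrite (le_trans (anormD _ _)) // anormZi mulr_natl mulr2n lerD.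
Qed.

End bounded_lift.

(** * Hilbert modules and matrix algebras *)

Section hilbert_module.
Variables (R : realType) (A : calg R) (I : finType).
Local Notation E := (I -> A).
Implicit Types (v w z : E) (i j : I) (c : A) (r : R).

Definition ip v w : A := \sum_i (v i)^# ** w i.
Definition hnorm v : R := Num.sqrt (nm (ip v v)).

Lemma ipDr v w z : ip v (w + z) = ip v w + ip v z.
Proof. by rewrite /ip -big_split; apply: eq_bigr => i _; rewrite amulDr. Qed.

Lemma ip_star v w : (ip v w)^# = ip w v.
Proof. by rewrite /ip astar_sum; apply: eq_bigr => i _; rewrite astarM astarK. Qed.

Lemma ipDl v w z : ip (v + w) z = ip v z + ip w z.
Proof. by rewrite -ip_star ipDr astarD !ip_star. Qed.

Lemma ipZr (a : R[i]) v w : ip v (a *: w) = a *: ip v w.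
Proof. by rewrite /ip scaler_sumr; apply: eq_bigr => i _; rewrite amulZr. Qed.

Lemma ipZl (a : R[i]) v w : ip (a *: v) w = a^*%C *: ip v w.
Proof. by rewrite -ip_star ipZr astarZ ip_star. Qed.

Lemma ipNr v w : ip v (- w) = - ip v w.
Proof. by rewrite -[- w]scaleN1r ipZr scaleN1r. Qed.

Lemma ipNl v w : ip (- v) w = - ip v w.
Proof. by rewrite -ip_star ipNr astarN ip_star. Qed.

Lemma ip_mulr v w c : ip v (fun i => w i ** c) = ip v w ** c.
Proof. by rewrite /ip amul_suml; apply: eq_bigr => i _; rewrite amulA. Qed.

Lemma ip_mull v w c : ip (fun i => v i ** c) w = c^# ** ip v w.
Proof. by rewrite -ip_star ip_mulr astarM ip_star. Qed.

Lemma ip_apos v : apos (ip v v).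
Proof. by apply: apos_sum => i _; exact: apos_star_square. Qed.

Lemma hnorm_ge0 v : 0 <= hnorm v.
Proof. exact: sqrtr_ge0. Qed.

Lemma hnorm_sqr v : hnorm v ^+ 2 = nm (ip v v).
Proof. by rewrite sqr_sqrtr // anorm_ge0. Qed.

Lemma hnorm_entry v i : nm (v i) <= hnorm v.
Proof.
rewrite -(@ler_pXn2r _ 2) ?nnegrE ?anorm_ge0 ?hnorm_ge0 // hnorm_sqr -anorm_sqr.
apply: apos_le_norm; first exact: apos_star_square.
rewrite /ip (bigD1 i) //= addrAC subrr add0r.
by apply: apos_sum => j _; exact: apos_star_square.
Qed.

(** Cauchy-Schwarz in a Hilbert module. Put [c = <v, w>], [r = |<v, v>|] and [z = r w - v c];
    expanding [<z, z> >= 0] and bounding [c^# <v, v> c] by [r c^# c] leaves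
    [r c^# c <= r^2 <w, w>]. *)
Lemma ip_le_hnorm v w : nm (ip v w) <= hnorm v * hnorm w.
Proof.
rewrite -(@ler_pXn2r _ 2) ?nnegrE ?mulr_ge0 ?anorm_ge0 ?hnorm_ge0 //.
rewrite exprMn !hnorm_sqr; set c := ip v w; set r := nm (ip v v).
have [r_le0|r_gt0] := lerP r 0.
  have v0 i : v i = 0.
    apply: anorm_le0; rewrite (le_trans (hnorm_entry v i)) // /hnorm.
    by rewrite ler0_sqrtr.
  rewrite /c /ip big1 => [|i _]; last by rewrite v0 astar0 amul0l.
  by rewrite anorm0 expr0n mulr_ge0 ?anorm_ge0.
pose z : E := r%:C *: w - (fun i => v i ** c).
have zz : ip z z = (r ^+ 2)%:C *: ip w w - 2%:R *: (r%:C *: (c^# ** c)) + c^# ** ip v v ** c.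
  rewrite /z ipDr !ipDl !ipNr !ipNl !(ipZr, ipZl) !ip_mulr !ip_mull.
  by rewrite -(ip_star v w) -/c conjc_real expr2 rmorphM; lmod.
have pq := @apos_conj_norm_sub _ _ (ip v v) c r (ip_star _ _) (lexx _).
have := aposD (ip_apos z) pq; rewrite zz.
have pc := aposZ r_gt0 (apos_star_square c).
have -> : (r ^+ 2)%:C *: ip w w - 2%:R *: (r%:C *: (c^# ** c)) + c^# ** ip v v ** c
    + (r%:C *: (c^# ** c) - c^# ** ip v v ** c) = (r ^+ 2)%:C *: ip w w - r%:C *: (c^# ** c).
  by lmod.
move/(apos_le_norm pc); rewrite !anormZr (gtr0_norm r_gt0) gtr0_norm ?exprn_gt0 //.
by rewrite anorm_sqr expr2 -mulrA ler_pM2l.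
Qed.

Lemma hnormD v w : hnorm (v + w) <= hnorm v + hnorm w.
Proof.
rewrite -(@ler_pXn2r _ 2) ?nnegrE ?addr_ge0 ?hnorm_ge0 // hnorm_sqr ipDr !ipDl.
rewrite (le_trans (anormD _ _)) //.
have := anormD (ip v v) (ip w v); have := anormD (ip v w) (ip w w).
have := ip_le_hnorm v v; have := ip_le_hnorm v w; have := ip_le_hnorm w v.
have := ip_le_hnorm w w; nra.
Qed.

Lemma hnormZ (r : R) v : hnorm (r%:C *: v) = `|r| * hnorm v.
Proof.
rewrite /hnorm ipZr ipZl conjc_real scalerA -rmorphM anormZr normrM.
by rewrite sqrtrM ?mulr_ge0 // -expr2 sqrtr_sqr normr_id.
Qed.

Lemma hnorm_le_sum v : hnorm v <= \sum_i nm (v i).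
Proof.
have s0 : 0 <= \sum_i nm (v i) by rewrite sumr_ge0 // => i _; exact: anorm_ge0.
rewrite -(@ler_pXn2r _ 2) ?nnegrE ?hnorm_ge0 // hnorm_sqr.
rewrite (le_trans (anorm_sum _ _ _)) // expr2 mulr_suml ler_sum // => i _.
rewrite anorm_sqr expr2 ler_wpM2l ?anorm_ge0 // (bigD1 i) //= lerDl.
by rewrite sumr_ge0 // => j _; exact: anorm_ge0.
Qed.

Definition hdelta j c : E := fun i => if i == j then c else 0.

Lemma hnorm_delta j c : hnorm (hdelta j c) = nm c.
Proof.
rewrite /hnorm /ip (bigD1 j) //= /hdelta eqxx big1 => [|i /negbTE ->]; last exact: amul0r.
by rewrite addr0 anorm_sqr sqrtr_sqr ger0_norm // anorm_ge0.
Qed.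

Definition mapply (T : I -> E) v : E := fun i => \sum_k T i k ** v k.
Definition mmul (S T : I -> E) : I -> E := fun i j => \sum_k S i k ** T k j.
Definition mstar (T : I -> E) : I -> E := fun i j => (T j i)^#.
Definition mnorm (T : I -> E) : R := opnorm setT hnorm (fun v => hnorm (mapply T v)).

Lemma mapplyM S T v : mapply (mmul S T) v = mapply S (mapply T v).
Proof.
apply/funext => i; rewrite /mapply /mmul.
under eq_bigr do rewrite amul_suml; rewrite exchange_big /=.
by apply: eq_bigr => k _; rewrite amul_sumr; apply: eq_bigr => l _; rewrite amulA.
Qed.

Lemma ip_mapply T v w : ip (mapply T v) w = ip v (mapply (mstar T) w).
Proof.
rewrite /ip /mapply; under eq_bigr do rewrite astar_sum amul_suml.
rewrite exchange_big /=; apply: eq_bigr => k _; rewrite amul_sumr.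
by apply: eq_bigr => i _; rewrite astarM amulA.
Qed.

Lemma mapply_bound T v : hnorm (mapply T v) <= (\sum_i \sum_j nm (T i j)) * hnorm v.
Proof.
rewrite (le_trans (hnorm_le_sum _)) // mulr_suml ler_sum // => i _.
rewrite (le_trans (anorm_sum _ _ _)) // mulr_suml ler_sum // => j _.
by rewrite (le_trans (anormM _ _)) // ler_wpM2l ?anorm_ge0 // hnorm_entry.
Qed.

Let mapplyZ T (r : R) v : hnorm (mapply T (r%:C *: v)) = `|r| * hnorm (mapply T v).
Proof.
rewrite -hnormZ; congr hnorm; apply/funext => i; rewrite /mapply [RHS]scaler_sumr.
by apply: eq_bigr => j _; rewrite amulZr.
Qed.

Lemma mnorm_le T (c : R) : 0 <= c -> (forall v, hnorm (mapply T v) <= c * hnorm v) ->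
  mnorm T <= c.
Proof. by move=> c0 Tc; apply: opnorm_le => // r v _; exact: hnormZ. Qed.

Lemma mnorm_ub T v : hnorm (mapply T v) <= mnorm T * hnorm v.
Proof.
apply: (opnorm_ub (D := setT) Logic.I _ hnorm_ge0 (fun r v _ => hnormZ r v)
  (fun r v _ => mapplyZ T r v)
  (c := \sum_i \sum_j nm (T i j))) => // w _; exact: mapply_bound.
Qed.

Lemma mnorm_ge0 T : 0 <= mnorm T.
Proof.
apply: (opnorm_ge0 (D := setT) Logic.I hnorm_ge0 (fun r v _ => hnormZ r v) _
  (c := \sum_i \sum_j nm (T i j))) => w; [exact: hnorm_ge0|move=> _; exact: mapply_bound].
Qed.

Lemma mnorm_le_sum T : mnorm T <= \sum_i \sum_j nm (T i j).
Proof.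
apply: mnorm_le => [|v]; last exact: mapply_bound.
by do 2!(rewrite sumr_ge0 // => ? _); exact: anorm_ge0.
Qed.

(** As [A] may lack a unit, the entry is read off by applying [T] to the vector whose only entry is
    the adjoint of [T i j], in place of a basis vector. *)
Lemma mnorm_entry T i j : nm (T i j) <= mnorm T.
Proof.
have [/anorm_le0 ->|Tij] := lerP (nm (T i j)) 0; first by rewrite anorm0 mnorm_ge0.
have := mnorm_ub T (hdelta j (T i j)^#); rewrite hnorm_delta anorm_star.
have := hnorm_entry (mapply T (hdelta j (T i j)^#)) i.
rewrite {1}/mapply (bigD1 j) //= {1}/hdelta eqxx big1 => [|k /negbTE kj]; last first.
  by rewrite /hdelta kj amul0r.
rewrite addr0 -{1}(astarK (T i j)) anorm_sqr anorm_star => /le_trans h /h.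
by rewrite expr2 ler_pM2r.
Qed.

Lemma mapplyD S T v : mapply (S + T) v = mapply S v + mapply T v.
Proof.
by apply/funext => i; rewrite /mapply -[RHS]big_split; apply: eq_bigr => j _; rewrite amulDl.
Qed.

Lemma mnormD S T : mnorm (S + T) <= mnorm S + mnorm T.
Proof.
apply: mnorm_le => [|v]; first by rewrite addr_ge0 ?mnorm_ge0.
by rewrite mapplyD (le_trans (hnormD _ _)) // mulrDl lerD // mnorm_ub.
Qed.

Lemma hnormZc (a : R[i]) v : hnorm (a *: v) = cabs a * hnorm v.
Proof.
rewrite /hnorm ipZr ipZl scalerA anormZ -/(cabs _) cabsM cabs_conj.
by rewrite sqrtrM ?mulr_ge0 ?cabs_ge0 // -expr2 sqrtr_sqr ger0_norm // cabs_ge0.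
Qed.

Lemma mnormZ_le (a : R[i]) T : mnorm (a *: T) <= cabs a * mnorm T.
Proof.
apply: mnorm_le => [|v]; first by rewrite mulr_ge0 ?cabs_ge0 ?mnorm_ge0.
have -> : mapply (a *: T) v = a *: mapply T v.
  apply/funext => i; rewrite /mapply [RHS]scaler_sumr.
  by apply: eq_bigr => j _; rewrite -amulZl.
by rewrite hnormZc -mulrA ler_wpM2l ?cabs_ge0 // mnorm_ub.
Qed.

Lemma mnorm_star_mul T : mnorm T ^+ 2 <= mnorm (mmul (mstar T) T).
Proof.
set S := mmul _ _; have S0 := mnorm_ge0 S.
rewrite -[leRHS]sqr_sqrtr // ler_pXn2r ?nnegrE ?mnorm_ge0 ?sqrtr_ge0 //.
apply: mnorm_le => [|v]; first exact: sqrtr_ge0.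
rewrite -(@ler_pXn2r _ 2) ?nnegrE ?hnorm_ge0 ?mulr_ge0 ?sqrtr_ge0 ?hnorm_ge0 //.
rewrite exprMn (sqr_sqrtr S0) [leLHS]hnorm_sqr ip_mapply -mapplyM (le_trans (ip_le_hnorm _ _)) //.
by rewrite mulrC expr2 mulrA ler_wpM2r ?hnorm_ge0 // mnorm_ub.
Qed.

Lemma mnormM S T : mnorm (mmul S T) <= mnorm S * mnorm T.
Proof.
apply: mnorm_le => [|v]; first by rewrite mulr_ge0 ?mnorm_ge0.
rewrite mapplyM (le_trans (mnorm_ub _ _)) // -mulrA ler_wpM2l ?mnorm_ge0 //.
exact: mnorm_ub.
Qed.

End hilbert_module.

Lemma cvg_sum0 (R : realType) (J : finType) (f : J -> nat -> R) :
  (forall j, f j @ \oo --> 0) -> \sum_j f j n @[n --> \oo] --> 0.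
Proof.
move=> f0; elim: (index_enum J) => [|j s IHs].
  by under eq_cvg do rewrite big_nil; exact: cvg_cst.
under eq_cvg do rewrite big_cons; by have := cvgD (f0 j) IHs; rewrite addr0; exact.
Qed.

Section matrix_algebra.
Variables (R : realType) (A : calg R) (I : finType).
Local Notation M := (I -> I -> A).
Implicit Types (S T : M) (u : nat -> M).

Lemma mmulA : associative (@mmul _ A I).
Proof.
move=> S T U; apply/funext => i; apply/funext => j; rewrite /mmul.
under eq_bigr do rewrite amul_sumr; rewrite exchange_big /=.
by apply: eq_bigr => k _; rewrite amul_suml; apply: eq_bigr => l _; rewrite amulA.
Qed.

Lemma mnorm_eq0 T : mnorm T = 0 -> T = 0.
Proof.
move=> T0; apply/funext => i; apply/funext => j; apply: anorm_le0.
by rewrite -T0 mnorm_entry.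
Qed.

Lemma mnormZ (a : R[i]) T : mnorm (a *: T) = complex.Re `|a| * mnorm T.
Proof.
rewrite -/(cabs a); apply/eqP; rewrite eq_le mnormZ_le /=.
have [->|a0] := eqVneq a 0; first by rewrite cabs0 mul0r mnorm_ge0.
have ca0 : 0 < cabs a.
  by rewrite lt_neqAle cabs_ge0 andbT eq_sym; apply: contra_neq a0; exact: cabs_eq0.
have := mnormZ_le a^-1 (a *: T); rewrite scalerA mulVf // scale1r.
have -> : cabs a^-1 = (cabs a)^-1.
  apply: (mulfI (lt0r_neq0 ca0)); rewrite -cabsM (divff a0) divff ?gt_eqF //.
  by rewrite -(rmorph1 (real_complex R)) cabs_real normr1.
by rewrite -(ler_pM2l ca0) mulrA divff ?gt_eqF // mul1r.
Qed.

Lemma mnorm_complete u : seq_cauchy (@mnorm _ A I) u ->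
  exists l, mnorm (u n - l) @[n --> \oo] --> (0 : R).
Proof.
move=> cu.
have /choice[l ul] (ij : I * I) : exists l, cvg_nm (fun n => u n ij.1 ij.2) l.
  apply: acomplete => eps /cu[N hN]; exists N => m n Nm Nn.
  exact: le_lt_trans (mnorm_entry (u m - u n) ij.1 ij.2) (hN m n Nm Nn).
exists (fun i j => l (i, j)).
apply: (@squeeze_cvgr _ _ _ _ (fun=> 0) (fun n => \sum_i \sum_j nm (u n i j - l (i, j)))).
- by apply: nearW => n; rewrite mnorm_ge0 mnorm_le_sum.
- exact: cvg_cst.
- by do 2!(apply: cvg_sum0 => ?); exact: (ul (_, _)).
Qed.

Definition matrix_calg : calg R.
Proof.
refine (@CAlg R (I -> I -> A : lmodType R[i]) (@mmul _ A I) (@mstar _ A I) (@mnorm _ A I)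
  mmulA _ _ _ _ _ _ _ _ (@mnorm_ge0 _ A I) mnorm_eq0 (@mnormD _ A I) mnormZ
  (@mnormM _ A I) (@mnorm_star_mul _ A I) mnorm_complete).
- move=> S T U; apply/funext => i; apply/funext => j; rewrite /mmul -[RHS]big_split.
  by apply: eq_bigr => k _; exact: amulDl.
- move=> S T U; apply/funext => i; apply/funext => j; rewrite /mmul -[RHS]big_split.
  by apply: eq_bigr => k _; exact: amulDr.
- move=> a S T; apply/funext => i; apply/funext => j; rewrite /mmul [RHS]scaler_sumr.
  by apply: eq_bigr => k _; exact: amulZl.
- move=> a S T; apply/funext => i; apply/funext => j; rewrite /mmul [RHS]scaler_sumr.
  by apply: eq_bigr => k _; exact: amulZr.
- by move=> S T; apply/funext => i; apply/funext => j; exact: astarD.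
- by move=> a S; apply/funext => i; apply/funext => j; exact: astarZ.
- move=> S T; apply/funext => i; apply/funext => j; rewrite /mmul /mstar astar_sum.
  by apply: eq_bigr => k _; exact: astarM.
- by move=> S; apply/funext => i; apply/funext => j; exact: astarK.
Defined.

End matrix_algebra.

Section matrix_maps.
Variables (R : realType) (A B : calg R).

Lemma calg_hom_sum (phi : A -> B) (J : Type) (s : seq J) (P : pred J) (F : J -> A) :
  calg_hom phi -> phi (\sum_(j <- s | P j) F j) = \sum_(j <- s | P j) phi (F j).
Proof. by move=> phiH; exact: (big_morph phi (calg_homD phiH) (calg_hom0 phiH)). Qed.

Definition matrix_map (I : finType) (phi : A -> B) (T : matrix_calg A I) : matrix_calg B I :=
  fun i j => phi (T i j).

Lemma matrix_map_hom (I : finType) (phi : A -> B) :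
  calg_hom phi -> calg_hom (matrix_map (I := I) phi).
Proof.
move=> phiH; split.
- move=> a S T; apply/funext => i; apply/funext => j.
  by case: phiH => L _ _; exact: L.
- move=> S T; apply/funext => i; apply/funext => j.
  rewrite /matrix_map /= /mmul calg_hom_sum //.
  by apply: eq_bigr => k _; rewrite (calg_homM phiH).
- by move=> T; apply/funext => i; apply/funext => j; exact: calg_hom_star.
Qed.

Definition block_diag (X J : finType) (F : X -> A -> matrix_calg B J) (a : A) :
    matrix_calg B (X * J)%type :=
  fun p q => if p.1 == q.1 then F p.1 a p.2 q.2 else 0.

(** Being a homomorphism, the block diagonal map is contractive by [calg_hom_le], whatever the
    number of blocks. *)
Lemma block_diag_hom (X J : finType) (F : X -> A -> matrix_calg B J) :
  (forall x, calg_hom (F x)) -> calg_hom (block_diag F).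
Proof.
move=> FH; split.
- move=> c a b; apply/funext => -[x i]; apply/funext => -[y j]; rewrite /block_diag /=.
  have -> : (c *: block_diag F a + block_diag F b) (x, i) (y, j) =
      c *: block_diag F a (x, i) (y, j) + block_diag F b (x, i) (y, j) by [].
  rewrite /block_diag /=; case: eqP => _; last by rewrite scaler0 addr0.
  by case: (FH x) => -> _ _.
- move=> a b; apply/funext => -[x i]; apply/funext => -[y j].
  rewrite [RHS]/= /mmul /block_diag /=.
  rewrite -(pair_bigA _ (fun z k => (if x == z then F x a i k else 0) **
    (if z == y then F z b k j else 0))) /=.
  rewrite (bigD1 x) //= eqxx [X in _ + X]big1 => [|z /negbTE zx]; last first.
    by rewrite big1 // => k _; rewrite eq_sym zx amul0l.
  rewrite addr0; case: eqP => _; last by rewrite big1 // => k _; rewrite amul0r.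
  by rewrite (calg_homM (FH x)).
- move=> a; apply/funext => -[x i]; apply/funext => -[y j].
  rewrite [RHS]/= /mstar /block_diag /= eq_sym; case: eqP => [->|_]; last by rewrite astar0.
  by rewrite (calg_hom_star (FH x)).
Qed.

End matrix_maps.

Section diagonal_operators.
Variables (R : realType) (A : calg R) (I : finType).

(** Entrywise [v^# a^# a v <= c^2 v^# v]; summing in the positive cone rather than in norm avoids a
    factor [#|I|]. *)
Lemma hnorm_diag_le (a : I -> A) (v : I -> A) (c : R) : 0 <= c ->
  (forall i, nm (a i) <= c) -> hnorm (fun i => a i ** v i) <= c * hnorm v.
Proof.
move=> c0 ac; rewrite -(@ler_pXn2r _ 2) ?nnegrE ?mulr_ge0 ?hnorm_ge0 //.
rewrite exprMn !hnorm_sqr -[c ^+ 2]ger0_norm ?exprn_ge0 // -anormZr.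
apply: apos_le_norm; first exact: ip_apos.
rewrite /ip scaler_sumr -sumrB; apply: apos_sum => i _.
rewrite astarM !amulA -(amulA _ _ (a i)).
apply: apos_conj_norm_sub; first by rewrite astarM astarK.
by rewrite anorm_sqr ler_pXn2r ?nnegrE ?anorm_ge0.
Qed.

End diagonal_operators.

(** * Reduced crossed products *)

Section calg_of_cstarAlg.
Variables (R : realType) (A : cstarAlgType R).
Implicit Types x y : A.

Lemma rnormE x : (rnorm x)%:C = `|x|.
Proof. by apply/RRe_real/ger0_real. Qed.

Lemma rnorm_ge0 x : 0 <= rnorm x.
Proof. by rewrite -ler0c rnormE. Qed.

Lemma rnorm_eq0 x : rnorm x = 0 -> x = 0.
Proof. by move=> x0; apply/normr0_eq0; rewrite -rnormE x0. Qed.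

Lemma rnormD x y : rnorm (x + y) <= rnorm x + rnorm y.
Proof. by rewrite -lecR rmorphD /= !rnormE ler_normD. Qed.

Lemma rnormZ (a : R[i]) x : rnorm (a *: x) = complex.Re `|a| * rnorm x.
Proof.
by apply: complexI; rewrite rmorphM /= -/(cabs a) !rnormE cabsE normrZ.
Qed.

Lemma rnormM x y : rnorm (cmul x y) <= rnorm x * rnorm y.
Proof. by rewrite -lecR rmorphM /= !rnormE cnormM. Qed.

Lemma rnorm_sqr_le x : rnorm x ^+ 2 <= rnorm (cmul (cstar x) x).
Proof. by rewrite -lecR rmorphXn /= !rnormE cnorm_cstar. Qed.

Lemma rnorm_complete (u : nat -> A) : seq_cauchy (@rnorm R A) u ->
  exists l, rnorm (u n - l) @[n --> \oo] --> (0 : R).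
Proof.
move=> cu.
have cau : cauchy (u n @[n --> \oo]).
  apply: cauchy_exP => e; rewrite ltcE /= => /andP[/eqP e_im e_re].
  have [N hN] := cu _ e_re; exists (u N), N => // n /= Nn.
  rewrite -ball_normE /= -rnormE ltcE /= -e_im eqxx /=; exact: hN.
have /cvg_ex[l ul] : cvgn u by apply: cauchy_cvg.
exists l; apply/cvgrPdist_lt => e e0.
have e0C : (0 : R[i]) < e%:C by rewrite ltcR.
have /cvgrPdist_lt/(_ _ e0C) := ul; apply: filterS => n.
rewrite -rnormE ltcR sub0r normrN ger0_norm ?rnorm_ge0 // => lt_e.
rewrite (_ : rnorm (u n - l) = rnorm (l - u n)) //.
by apply: complexI; rewrite !rnormE distrC.
Qed.

Definition calg_of : calg R :=
  @CAlg R A cmul cstar (@rnorm R A) (@cmulA R A) (@cmulDl R A) (@cmulDr R A)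
    (@cmulZl R A) (@cmulZr R A) (@cstarD R A) (@cstarZ R A) (@cstarM R A)
    (@cstarK R A) rnorm_ge0 rnorm_eq0 rnormD rnormZ rnormM rnorm_sqr_le rnorm_complete.

End calg_of_cstarAlg.

Lemma fsum_fset (K : choiceType) (V : nmodType) (F : {fset K}) (f : K -> V) :
  (forall x, x \notin F -> f x = 0) ->
  \sum_(x \in [set: K]) f x = \sum_(i : F) f (val i).
Proof. by move=> f0; rewrite (fsbigTE F) // big_seq_fsetE. Qed.

Section finitely_supported.
Variables (R : realType) (G : groupType) (A : gcstarAlgType R G).
Local Notation cA := (calg_of A).
Implicit Types (f xi eta : G -> cA) (F : {fset G}) (g h k : G).

Definition fsupp f F := forall g, g \notin F -> f g = 0.

Lemma Cc_fsupp f : Cc (f : G -> A) -> exists F, fsupp f F.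
Proof.
rewrite /Cc /= => /finite_fsetP[F fF]; exists F => g; apply: contraNeq => fg.
by have : [set` F] g by rewrite -fF.
Qed.

Lemma fsupp_Cc f F : fsupp f F -> Cc (f : G -> A).
Proof.
move=> fF; apply: (sub_finite_set (B := [set` F])) => [g /= fg|]; last exact: finite_fset.
by apply: contraNT fg => /fF ->.
Qed.

Lemma fsuppS f F F' : (F `<=` F')%fset -> fsupp f F -> fsupp f F'.
Proof. by move=> /fsubsetP FF' fF g gF; apply: fF; apply: contra gF; exact: FF'. Qed.

Definition restr F f : F -> cA := fun i => f (val i).
Arguments restr F f _ : clear implicits.

Definition extend F (v : F -> cA) : G -> cA := fun g => if insub g is Some i then v i else 0.

Lemma extend_fsupp F (v : F -> cA) : fsupp (extend v) F.
Proof. by move=> g gF; rewrite /extend insubF //; exact/negbTE. Qed.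

Lemma extendK F (v : F -> cA) : restr F (extend v) = v.
Proof. by apply/funext => i; rewrite /restr /extend valK. Qed.

Lemma l2norm_restr f F : fsupp f F -> l2norm (f : G -> A) = hnorm (restr F f).
Proof.
move=> fF; rewrite /l2norm /hnorm /ip (fsum_fset (F := F)) // => g gF.
exact: (etrans (congr1 (amul _) (fF g gF)) (amul0r _)).
Qed.

Lemma restr_le_l2norm f F : Cc (f : G -> A) -> hnorm (restr F f) <= l2norm (f : G -> A).
Proof.
move=> /Cc_fsupp[F' fF']; pose FF := (F `|` F')%fset.
have fFF : fsupp f FF by apply: fsuppS fF'; exact: fsubsetUr.
rewrite (l2norm_restr fFF) -(@ler_pXn2r _ 2) ?nnegrE ?hnorm_ge0 // !hnorm_sqr.
(* [phi'] extends the sum over [F] by zero, so that both sums run over [FF] and compare termwise. *)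
pose phi g := (f g)^# ** f g; pose phi' g := if g \in F then phi g else 0.
have -> : ip (restr F f) (restr F f) = \sum_(i : FF) phi' (val i).
  rewrite -fsum_fset; last by move=> g; rewrite inE negb_or /phi' => /andP[/negbTE ->].
  rewrite (fsum_fset (F := F)) => [|g /negbTE gF]; last by rewrite /phi' gF.
  by apply: eq_bigr => i _; rewrite /phi' (valP i).
have phi_pos g : apos (phi g) by exact: apos_star_square.
apply: apos_le_norm.
  by apply: apos_sum => i _; rewrite /phi'; case: ifP => _; [exact: phi_pos|exact: apos0].
rewrite /ip -sumrB; apply: apos_sum => i _; rewrite /phi'; case: ifP => _.
  by rewrite subrr; exact: apos0.
by rewrite subr0; exact: phi_pos.
Qed.

Lemma l2norm_translate f g : l2norm (fun h => f (g * h)%g : A) = l2norm (f : G -> A).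
Proof.
rewrite /l2norm; congr (Num.sqrt (rnorm _)).
rewrite -(reindex_fsbigT (fun h => g * h)%g (fun h => cmul (cstar (f h)) (f h : A))) //.
by exists (fun h => g^-1 * h)%g => h; rewrite ?mulKg ?mulVKg.
Qed.

Lemma l2norm_ge0 f : 0 <= l2norm (f : G -> A).
Proof. exact: sqrtr_ge0. Qed.

Lemma Cc0 : Cc (0 : G -> A).
Proof. by apply: (@fsupp_Cc _ fset0) => g. Qed.

Lemma CcZ (a : R[i]) f : Cc (f : G -> A) -> Cc (a *: f : G -> A).
Proof.
move=> /Cc_fsupp[F fF]; apply: (@fsupp_Cc _ F) => g gF.
by have -> : (a *: f) g = a *: f g by []; rewrite fF // scaler0.
Qed.

Lemma CcD f f' : Cc (f : G -> A) -> Cc (f' : G -> A) -> Cc (f + f' : G -> A).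
Proof.
move=> /Cc_fsupp[F fF] /Cc_fsupp[F' fF']; apply: (@fsupp_Cc _ (F `|` F')%fset) => g.
rewrite inE negb_or => /andP[gF gF'].
have -> : (f + f') g = f g + f' g by [].
by rewrite fF // fF' // addr0.
Qed.

End finitely_supported.
Arguments restr {R G A} F f _.

Section regular_representation.
Variables (R : realType) (G : groupType) (A : gcstarAlgType R G).
Local Notation cA := (calg_of A).
Implicit Types (f xi eta : G -> cA) (F : {fset G}) (g h k : G) (x : cA).

Lemma gact_calg_hom g : calg_hom (gact g : cA -> cA).
Proof. exact: (gact_hom g). Qed.

Lemma gact_norm_le g x : nm (gact g x : cA) <= nm x.
Proof. exact: calg_hom_le (gact_calg_hom g) x. Qed.

Lemma gact0 g : gact g (0 : A) = 0.
Proof. exact: calg_hom0 (gact_calg_hom g). Qed.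

Definition kernel f g h : cA := gact g^-1%g (f (g * h^-1)%g : A).

Lemma regular_repE f xi F g : fsupp xi F ->
  regular_rep (f : G -> A) xi g = \sum_(i : F) kernel f g (val i) ** xi (val i).
Proof.
move=> xF; rewrite /regular_rep.
rewrite (@reindex_fsbigT _ _ _ _ _ (fun h => g * h^-1)%g); last first.
  by exists (fun k => k^-1 * g)%g => h; rewrite invgM invgK ?mulgVK ?mulVKg.
rewrite (fsum_fset (F := F)) => [|h hF].
  by apply: eq_bigr => i _; rewrite /kernel invgM invgK mulgVK.
rewrite invgM invgK mulgVK.
exact: (etrans (congr1 (amul _) (xF h hF)) (amul0r _)).
Qed.

Lemma regular_repE_supp f xi F g : fsupp f F ->
  regular_rep (f : G -> A) xi g =
  \sum_(k : F) (gact g^-1%g (f (val k) : A) : cA) ** xi ((val k)^-1 * g)%g.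
Proof.
move=> fF; rewrite /regular_rep (fsum_fset (F := F)) // => k kF.
rewrite (fF k kF) gact0; exact: (amul0l (xi (k^-1 * g)%g)).
Qed.

Lemma regular_rep_fsupp f xi K F : fsupp f K -> fsupp xi F ->
  fsupp (regular_rep (f : G -> A) xi : G -> cA) [fset k * h | k in K, h in F]%g%fset.
Proof.
move=> fK xF g gKF; rewrite (regular_repE _ _ xF) big1 // => i _.
rewrite /kernel fK ?gact0; first exact: amul0l.
apply: contra gKF => gK; apply/imfset2P; exists (g * (val i)^-1)%g => //.
by exists (val i); rewrite ?(valP i) // mulgVK.
Qed.

Definition cmat F f : matrix_calg cA F := fun i j => kernel f (val i) (val j).
Arguments cmat F f _ _ : clear implicits.

Lemma restr_regular_rep F f xi : fsupp xi F ->
  restr F (regular_rep (f : G -> A) xi : G -> cA) = mapply (cmat F f) (restr F xi).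
Proof. by move=> xF; apply/funext => i; exact: regular_repE. Qed.

Lemma hnorm_sum (I J : finType) (v : J -> I -> cA) :
  hnorm (fun i => \sum_j v j i) <= \sum_j hnorm (v j).
Proof.
elim: (index_enum J) => [|j s IHs].
  rewrite big_nil (_ : (fun i => _) = (0 : R)%:C *: (fun=> 0) :> (I -> cA)).
    by rewrite hnormZ normr0 mul0r.
  by apply/funext => i; rewrite big_nil [RHS]scaler0.
rewrite big_cons (_ : (fun i => _) = v j + (fun i => \sum_(j <- s) v j i)).
  by rewrite (le_trans (hnormD _ _)) // lerD2l.
by apply/funext => i; rewrite big_cons.
Qed.

(** [f] acts as a sum over its support of translations followed by diagonal operators, each of norm
    at most [|f k|]. The bound does not depend on [F], so the supremum defining [reduced_norm] is
    finite. *)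
Lemma cmat_norm_le_sum F K f : fsupp f K -> nm (cmat F f) <= \sum_(k : K) nm (f (val k)).
Proof.
move=> fK; apply: mnorm_le => [|v].
  by apply: sumr_ge0 => k _; exact: anorm_ge0.
rewrite -{1}[v]extendK -restr_regular_rep; last exact: extend_fsupp.
set xi := extend v.
have -> : restr F (regular_rep (f : G -> A) xi : G -> cA) = fun i : F =>
    \sum_(k : K) (gact (val i)^-1%g (f (val k) : A) : cA) ** xi ((val k)^-1 * val i)%g.
  by apply/funext => i; exact: regular_repE_supp.
rewrite (le_trans (hnorm_sum _)) // mulr_suml; apply: ler_sum => k _.
pose tv : F -> cA := restr F (fun g => xi ((val k)^-1 * g)%g).
apply: (le_trans (hnorm_diag_le tv (anorm_ge0 (f (val k))) _)) => [i|].
  exact: gact_norm_le.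
rewrite ler_wpM2l ?anorm_ge0 // (le_trans (restr_le_l2norm _ _)) //.
  apply: (@fsupp_Cc _ _ _ _ [fset val k * g | g in F]%g%fset) => g gF.
  apply: (extend_fsupp v); apply: contra gF => gF; apply/imfsetP.
  by exists ((val k)^-1 * g)%g; rewrite //= mulVKg.
by rewrite l2norm_translate (l2norm_restr (F := F)) ?extendK //; exact: extend_fsupp.
Qed.

(** Once [F] contains the supports of [xi] and of its image, compressing to [F] loses nothing. *)
Lemma l2norm_regular_rep_le f xi (c : R) : Cc (f : G -> A) -> Cc (xi : G -> A) ->
  (forall F, nm (cmat F f) <= c) ->
  l2norm (regular_rep (f : G -> A) xi) <= c * l2norm (xi : G -> A).
Proof.
move=> /Cc_fsupp[K fK] /Cc_fsupp[F xF] fc.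
pose F' := (F `|` [fset k * h | k in K, h in F]%g)%fset.
have xF' : fsupp xi F' by apply: fsuppS xF; exact: fsubsetUl.
have rF' : fsupp (regular_rep (f : G -> A) xi : G -> cA) F'.
  by apply: fsuppS (regular_rep_fsupp fK xF); exact: fsubsetUr.
rewrite (l2norm_restr rF') (l2norm_restr xF') restr_regular_rep //.
apply: le_trans (mnorm_ub _ _) _; apply: ler_wpM2r; [exact: hnorm_ge0|exact: fc].
Qed.

Lemma l2normZ (r : R) xi : Cc (xi : G -> A) ->
  l2norm (r%:C *: xi : G -> A) = `|r| * l2norm (xi : G -> A).
Proof.
move=> /Cc_fsupp[F xF]; rewrite !(l2norm_restr (F := F)) -?hnormZ // => g gF.
by have -> : (r%:C *: xi) g = r%:C *: xi g by []; rewrite xF // scaler0.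
Qed.

Lemma regular_repZ f xi (a : R[i]) : Cc (xi : G -> A) ->
  regular_rep (f : G -> A) (a *: xi : G -> A) = a *: regular_rep (f : G -> A) xi.
Proof.
move=> /Cc_fsupp[F xF]; apply/funext => g.
have aF : fsupp (a *: xi : G -> cA) F.
  by move=> h hF; have -> : (a *: xi) h = a *: xi h by []; rewrite xF // scaler0.
have -> : (a *: regular_rep (f : G -> A) xi) g = a *: regular_rep (f : G -> A) xi g by [].
rewrite (regular_repE _ _ aF) (regular_repE _ _ xF) [RHS]scaler_sumr.
by apply: eq_bigr => i _; exact: (@amulZr _ cA).
Qed.

Lemma Cc_regular_rep f xi : Cc (f : G -> A) -> Cc (xi : G -> A) ->
  Cc (regular_rep (f : G -> A) xi).
Proof.
move=> /Cc_fsupp[K fK] /Cc_fsupp[F xF].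
exact: (@fsupp_Cc _ _ _ (regular_rep (f : G -> A) xi : G -> cA) _ (regular_rep_fsupp fK xF)).
Qed.

Lemma reduced_norm_le f (c : R) : 0 <= c ->
  (forall xi, Cc (xi : G -> A) ->
     l2norm (regular_rep (f : G -> A) xi) <= c * l2norm (xi : G -> A)) ->
  reduced_norm (f : G -> A) <= c.
Proof.
move=> c0 fc.
apply: (@opnorm_le R (G -> A : lmodType R[i]) (@Cc _ _ A) (@l2norm _ _ A)
  (fun xi => l2norm (regular_rep (f : G -> A) xi))) => //; first exact: Cc0.
by move=> r xi; exact: l2normZ.
Qed.

Lemma reduced_norm_le_cmat f (c : R) : Cc (f : G -> A) -> 0 <= c ->
  (forall F, nm (cmat F f) <= c) -> reduced_norm (f : G -> A) <= c.
Proof. by move=> fC c0 fc; apply: reduced_norm_le => // xi xC; exact: l2norm_regular_rep_le. Qed.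

Lemma reduced_norm_ub f xi : Cc (f : G -> A) -> Cc (xi : G -> A) ->
  l2norm (regular_rep (f : G -> A) xi) <= reduced_norm (f : G -> A) * l2norm (xi : G -> A).
Proof.
move=> fC xC; have [K fK] := Cc_fsupp fC.
apply: (@opnorm_ub R (G -> A : lmodType R[i]) (@Cc _ _ A) (@l2norm _ _ A)
  (fun xi => l2norm (regular_rep (f : G -> A) xi)) _ _ _ _ _ (\sum_(k : K) nm (f (val k)))) => //.
- exact: Cc0.
- by move=> r eta; exact: CcZ.
- by move=> eta; exact: l2norm_ge0.
- by move=> r eta; exact: l2normZ.
- move=> r eta eC; rewrite regular_repZ // l2normZ //; exact: Cc_regular_rep.
- by move=> eta eC; apply: l2norm_regular_rep_le => // F; exact: cmat_norm_le_sum.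
Qed.

Lemma cmat_le_reduced_norm F f : Cc (f : G -> A) -> nm (cmat F f) <= reduced_norm (f : G -> A).
Proof.
move=> fC; apply: mnorm_le => [|v].
  have [K fK] := Cc_fsupp fC.
  apply: (@opnorm_ge0 R (G -> A : lmodType R[i]) (@Cc _ _ A) (@l2norm _ _ A)
    (fun xi => l2norm (regular_rep (f : G -> A) xi)) _ _ _ _ (\sum_(k : K) nm (f (val k)))) => //.
  + exact: Cc0.
  + by move=> eta; exact: l2norm_ge0.
  + by move=> r eta; exact: l2normZ.
  + by move=> eta; exact: l2norm_ge0.
  + by move=> eta eC; apply: l2norm_regular_rep_le => // F'; exact: cmat_norm_le_sum.
have vF := extend_fsupp v; have vC := fsupp_Cc vF.
rewrite -{1}[v]extendK -restr_regular_rep //.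
rewrite (le_trans (restr_le_l2norm _ _)) //; first exact: Cc_regular_rep.
rewrite (le_trans (reduced_norm_ub fC vC)) // (l2norm_restr vF) extendK //.
Qed.

Lemma reduced_norm_ge0 f : Cc (f : G -> A) -> 0 <= reduced_norm (f : G -> A).
Proof.
by move=> fC; apply: le_trans (cmat_le_reduced_norm fset0 fC); exact: anorm_ge0.
Qed.

Lemma cmatD F f f' : cmat F (f + f') = cmat F f + cmat F f'.
Proof.
by apply/funext => i; apply/funext => j; exact: (calg_homD (gact_calg_hom _)).
Qed.

Lemma reduced_normD f f' : Cc (f : G -> A) -> Cc (f' : G -> A) ->
  reduced_norm (f + f' : G -> A) <= reduced_norm (f : G -> A) + reduced_norm (f' : G -> A).
Proof.
move=> fC fC'; apply: reduced_norm_le_cmat; first exact: CcD.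
  by rewrite addr_ge0 ?reduced_norm_ge0.
by move=> F; rewrite cmatD (le_trans (anormD _ _)) // lerD // cmat_le_reduced_norm.
Qed.

Lemma reduced_norm_le_sum f K : fsupp f K ->
  reduced_norm (f : G -> A) <= \sum_(k : K) nm (f (val k)).
Proof.
move=> fK; apply: reduced_norm_le_cmat; first exact: fsupp_Cc fK.
  by apply: sumr_ge0 => k _; exact: anorm_ge0.
by move=> F; exact: cmat_norm_le_sum.
Qed.

End regular_representation.
Arguments cmat {R G A} F f _ _.

(** * Averaging matrices along their diagonals *)

Section averaging.
Variables (R : realType) (G : groupType) (A : gcstarAlgType R G).
Local Notation cA := (calg_of A).
Implicit Types (f xi eta : G -> cA) (F : {fset G}) (g h k : G) (x : cA).

(* A left inverse, up to a multiplier tending to 1 along a Folner sequence, of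
   the compression [cmat F]. *)
Definition average F (Y : matrix_calg cA F) : G -> cA := fun k =>
  (#|`F|%:R^-1)%:C *: \sum_(i : F) \sum_(j : F)
    (if (val i * (val j)^-1)%g == k then (gact (val i) (Y i j : A) : cA) else 0).

Lemma average_fsupp F (Y : matrix_calg cA F) :
  fsupp (average Y) [fset g * h^-1 | g in F, h in F]%g%fset.
Proof.
move=> k kF; rewrite /average big1 ?scaler0 // => i _; rewrite big1 // => j _.
case: eqP => // ijk; case/negP: kF; apply/imfset2P.
by exists (val i); [exact: valP|exists (val j) => //; exact: valP].
Qed.

Lemma averageB F (Y Z : matrix_calg cA F) : average (Y - Z) = average Y - average Z.
Proof.
apply/funext => k; have -> : (average Y - average Z) k = average Y k - average Z k by [].
rewrite /average -scalerBr -sumrB; congr (_ *: _); apply: eq_bigr => i _.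
rewrite -sumrB; apply: eq_bigr => j _; case: ifP => _; last by rewrite subr0.
by have -> : (Y - Z) i j = Y i j - Z i j by []; rewrite (calg_homB (gact_calg_hom A _)).
Qed.

Lemma regular_rep_average F (Y : matrix_calg cA F) xi g : Cc (xi : G -> A) ->
  regular_rep (average Y : G -> A) xi g = (#|`F|%:R^-1)%:C *: \sum_(i : F) \sum_(j : F)
    (gact (g^-1 * val i)%g (Y i j : A) : cA) ** xi (val j * (val i)^-1 * g)%g.
Proof.
move=> xC; rewrite (regular_repE_supp _ _ (average_fsupp Y)).
set K := imfset2 _ _ _ _.
under eq_bigr => k _.
  rewrite /average (calg_homZ (gact_calg_hom A _)).
  rewrite (calg_hom_sum _ _ _ (gact_calg_hom A _)).
  rewrite amulZl amul_suml.
  under eq_bigr => i _.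
    rewrite (calg_hom_sum _ _ _ (gact_calg_hom A _)).
    rewrite amul_suml; over.
  over.
(* For fixed [i] and [j] only [k = i j^-1] contributes, and it lies in [K]. *)
rewrite -scaler_sumr exchange_big; congr (_ *: _); apply: eq_bigr => i _.
rewrite exchange_big; apply: eq_bigr => j _.
have ijK : (val i * (val j)^-1)%g \in K.
  by apply/imfset2P; exists (val i); [exact: valP|exists (val j) => //; exact: valP].
rewrite (bigD1 [` ijK]%fset) //= eqxx big1 ?addr0 => [|k kij].
  rewrite -gactM invgM invgK; congr (_ ** xi _).
case: ifP => [/eqP ijk|_]; last first.
  by rewrite [gact _ _]gact0; exact: (amul0l (xi _)).
by case/negP: kij; apply/eqP/val_inj; rewrite /= ijk.
Qed.

Lemma sum_translate F (X : {fset G}) g (phi : G -> cA) : fsupp phi F ->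
  (forall h, h \in F -> (g^-1 * h)%g \in X) ->
  \sum_(x : X) phi (g * val x)%g = \sum_(p : F) phi (val p).
Proof.
move=> pF FX; rewrite -(fsum_fset (fun h hF => pF h hF)).
rewrite (@reindex_fsbigT _ _ _ _ _ (fun h => g * h)%g); last first.
  by exists (fun h => g^-1 * h)%g => h; rewrite ?mulKg ?mulVKg.
rewrite (fsum_fset (F := X)) // => x xX; apply: pF; apply: contra xX => /FX.
by rewrite mulKg.
Qed.

(** The compressing isometry is [n^(-1/2) lift], where [lift f (x, i) = f (i x)]. Its adjoint is
    avoided by pairing with the image [eta] of [xi]: [n <eta, eta>] equals
    [<lift eta, D(Y) (lift xi)>], and Cauchy-Schwarz applies. *)
Lemma average_norm_le F (Y : matrix_calg cA F) : reduced_norm (average Y : G -> A) <= nm Y.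
Proof.
apply: reduced_norm_le => [|xi xC]; first exact: anorm_ge0.
set eta : G -> cA := regular_rep _ _.
have eC : Cc (eta : G -> A) by apply: Cc_regular_rep => //; exact: fsupp_Cc (average_fsupp Y).
have [Fx xF] := Cc_fsupp xC; have [Fe eF] := Cc_fsupp eC.
pose P := (Fx `|` Fe)%fset.
have xP : fsupp xi P by apply: fsuppS xF; exact: fsubsetUl.
have eP : fsupp eta P by apply: fsuppS eF; exact: fsubsetUr.
(* A finite substitute for blocks indexed by all of [G]: for [p] in [P] and [i] in [F], the solution
   [x] of [i x = p] lies in [X]. *)
pose X := [fset i^-1 * p | i in F, p in P]%g%fset.
have FPX (i : F) p : p \in P -> ((val i)^-1 * p)%g \in X.
  by move=> pP; apply/imfset2P; exists (val i); [exact: valP|exists p].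
pose n : R := #|`F|%:R.
(* For empty [F] the normalizing factor is the inverse of 0, and the average is zero as an empty
   sum. *)
have [F0|Fgt0] := posnP #|`F|.
  have Fno (i : F) : False.
    have iF : val i \in F := valP i.
    by move: (val i) iF => g; rewrite (cardfs0_eq F0) inE.
  have S0 (v : F -> cA) : \sum_i v i = 0 by rewrite big1 // => i; case: (Fno i).
  have -> : l2norm (eta : G -> A) = 0.
    rewrite (l2norm_restr eP); apply/eqP; rewrite eq_le hnorm_ge0 andbT.
    rewrite (le_trans (hnorm_le_sum _)) // big1 // => p _.
    by rewrite /restr /eta regular_rep_average // S0 scaler0 anorm0.
  by rewrite mulr_ge0 ?anorm_ge0 // l2norm_ge0.
have n0 : 0 < n by rewrite ltr0n.
pose D := block_diag (fun x : X => matrix_map (I := F) (gact (val x)^-1%g : cA -> cA)).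
have DH : calg_hom D.
  by apply: block_diag_hom => x; apply: matrix_map_hom; exact: (gact_calg_hom A).
pose lift (f : G -> cA) : X * F -> cA := fun p => f (val p.2 * val p.1)%g.
have hnorm_lift f : fsupp f P -> hnorm (lift f) = Num.sqrt n * l2norm (f : G -> A).
  move=> fP; rewrite (l2norm_restr fP) /hnorm -sqrtrM; last exact: ltW.
  congr Num.sqrt; rewrite -(gtr0_norm n0) -anormZr; congr nm.
  rewrite /ip -(pair_bigA _ (fun (x : X) (i : F) =>
    (f (val i * val x)%g)^# ** f (val i * val x)%g)) /= exchange_big /=.
  transitivity (\sum_(i : F) ip (restr P f) (restr P f)).
    apply: eq_bigr => i _; apply: (@sum_translate P X (val i) (fun g => (f g)^# ** f g)).
      by move=> g gP; rewrite fP // amul0r.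
    exact: FPX.
  by rewrite sumr_const -cardfE -scaler_nat rmorph_nat.
have ip_lift : ip (lift eta) (mapply (D Y) (lift xi)) = n%:C *: ip (restr P eta) (restr P eta).
  pose psi (i : F) p := (eta p)^# ** \sum_(j : F)
    (gact (p^-1 * val i)%g (Y i j : A) : cA) ** xi (val j * (val i)^-1 * p)%g.
  have mE (x : X) (i : F) : mapply (D Y) (lift xi) (x, i) = \sum_(j : F)
      (gact (val x)^-1%g (Y i j : A) : cA) ** xi (val j * val x)%g.
    rewrite /mapply /D /block_diag.
    rewrite -(pair_bigA _ (fun y j => (if x == y then
      matrix_map (I := F) (gact (val x)^-1%g : cA -> cA) Y i j else 0) ** lift xi (y, j))) /=.
    rewrite (bigD1 x) //= eqxx [X in _ + X]big1 ?addr0 // => y /negbTE yx.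
    by rewrite big1 // => j _; rewrite [x == y]eq_sym yx; exact: (@amul0l _ cA).
  transitivity (\sum_(i : F) \sum_(p : P) psi i (val p)).
    rewrite /ip (eq_bigr (fun p : X * F => psi p.2 (val p.2 * val p.1)%g)); last first.
      move=> [x i] _; rewrite mE /psi /lift; congr (_ ** _); apply: eq_bigr => j _.
      by rewrite invgM mulgVK mulgA mulgVK.
    rewrite -(pair_bigA _ (fun (x : X) (i : F) => psi i (val i * val x)%g)) exchange_big /=.
    apply: eq_bigr => i _; apply: sum_translate; last exact: FPX.
    by move=> g gP; rewrite /psi eP // astar0 amul0l.
  rewrite exchange_big /ip scaler_sumr; apply: eq_bigr => p _.
  rewrite /psi -amul_sumr -amulZr; congr (_ ** _).
  rewrite /restr /eta regular_rep_average // scalerA -rmorphM divff ?gt_eqF //.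
  by rewrite rmorph1 scale1r.
have [e_le0|e_gt0] := lerP (l2norm (eta : G -> A)) 0.
  by rewrite (le_trans e_le0) // mulr_ge0 ?anorm_ge0 // l2norm_ge0.
rewrite -(ler_pM2l e_gt0) -(ler_pM2l n0) -expr2 {1}(l2norm_restr eP) hnorm_sqr.
rewrite -{1}(gtr0_norm n0) -anormZr -ip_lift (le_trans (ip_le_hnorm _ _)) //.
rewrite (hnorm_lift _ eP) -{2}(sqr_sqrtr (ltW n0)) expr2.
have : hnorm (mapply (D Y) (lift xi)) <= nm Y * (Num.sqrt n * l2norm (xi : G -> A)).
  rewrite -(hnorm_lift _ xP) (le_trans (mnorm_ub _ _)) // ler_wpM2r ?hnorm_ge0 //.
  exact: calg_hom_le DH Y.
move=> le_h; apply: le_trans (ler_wpM2l _ le_h) _.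
  by rewrite mulr_ge0 ?sqrtr_ge0 // ltW.
by rewrite le_eqVlt; apply/orP; left; apply/eqP; ring.
Qed.

End averaging.

(** * Folner approximation *)

Section folner_approximation.
Variables (R : realType) (G : groupType) (A : gcstarAlgType R G).
Local Notation cA := (calg_of A).
Implicit Types (f : G -> cA) (F K : {fset G}) (g h k : G).

Lemma sum_fset_cond (F S : {fset G}) (c : R) :
  \sum_(i : F) (if val i \in S then 0 else c) = #|` F `\` S|%fset%:R * c.
Proof.
rewrite -(big_seq_fsetE _ F xpredT (fun g => if g \in S then 0 else c)) /=.
rewrite (eq_bigr (fun g => if g \notin S then c else 0)) => [|g _]; last by case: (g \in S).
rewrite -big_mkcond big_fset_condE (_ : [fset i | i in F & i \notin S]%fset = (F `\` S)%fset).
  by rewrite big_seq_fsetE sumr_const -cardfE mulr_natl.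
by apply/fsetP => g; rewrite !inE andbC.
Qed.

(** On row [i], [gact i] undoes the twist of the kernel, and the column [j = k^-1 i] exists in [F]
    exactly when [i] lies in [k F]. So the average multiplies [f k] by the proportion of [F] lying
    in [k F]. *)
Lemma average_cmat_dist F f k : F != fset0 -> nm (f k - average (cmat F f) k) <=
  #|` fset_symdiff (left_translate k F) F|%:R / #|` F|%:R * nm (f k).
Proof.
move=> F0; have n0 : 0 < #|`F|%:R :> R by rewrite ltr0n cardfs_gt0.
have -> : f k - average (cmat F f) k = (#|`F|%:R^-1)%:C *:
    \sum_(i : F) (if val i \in left_translate k F then 0 else f k).
  have {1}-> : f k = (#|`F|%:R^-1)%:C *: \sum_(i : F) f k.
    rewrite sumr_const -cardfE -[f k *+ _]scaler_nat -(rmorph_nat (real_complex R)).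
    by rewrite scalerA -rmorphM mulVf ?gt_eqF // rmorph1 scale1r.
  rewrite /average -scalerBr -sumrB; congr (_ *: _); apply: eq_bigr => i _.
  have -> : \sum_(j : F) (if (val i * (val j)^-1)%g == k
      then (gact (val i) (cmat F f i j : A) : cA) else 0) =
      \sum_(j : F) (if (val i * (val j)^-1)%g == k then f k else 0).
    apply: eq_bigr => j _; case: eqP => // <-; rewrite /cmat /kernel.
    by rewrite -gactM mulgV gact1.
  case: ifPn => [/imfsetP[h /= hF ih]|kF].
    rewrite (bigD1 [` hF]%fset) //= ih mulgK eqxx big1 ?addr0 ?subrr // => j jh.
    case: eqP => // ijk; case/eqP: jh; apply: val_inj => /=.
    by apply: (mulgI k); rewrite -{1}ijk mulgVK.
  rewrite big1 ?subr0 // => j _; case: eqP => // ijk; case/negP: kF.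
  by apply/imfsetP; exists (val j); rewrite ?(valP j) // -ijk mulgVK.
rewrite anormZr gtr0_norm ?invr_gt0 // [X in _ <= X * _]mulrC -mulrA ler_pM2l ?invr_gt0 //.
rewrite (le_trans (anorm_sum _ _ _)) //.
rewrite (eq_bigr (fun i : F => if val i \in left_translate k F then 0 else nm (f k))).
  rewrite sum_fset_cond ler_wpM2r ?anorm_ge0 // ler_nat fsubset_leq_card //.
  exact: fsubsetUr.
by move=> i _; case: ifP => _ //; exact: anorm0.
Qed.

(** Pointwise convergence suffices: the average vanishes off the finite support of [f], and the
    reduced norm is at most the sum of the norms of the values. *)
Lemma folner_average f (Fn : nat -> {fset G}) (eps : R) : Cc (f : G -> A) ->
  folner_sequence R Fn -> 0 < eps ->
  exists F, reduced_norm (f - average (cmat F f) : G -> A) < eps.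
Proof.
move=> /Cc_fsupp[K fK] [F0 Fcvg] eps0.
pose d (k : K) n : R :=
  #|` fset_symdiff (left_translate (val k) (Fn n)) (Fn n)|%:R / #|` Fn n|%:R * nm (f (val k)).
have : \sum_k d k n @[n --> \oo] --> 0.
  apply: cvg_sum0 => k; have := cvgM (Fcvg (val k)) (@cvg_cst _ (nm (f (val k))) _ \oo _).
  by rewrite mul0r; exact.
move/cvgrPdist_lt => /(_ _ eps0)[N _ /(_ N (leqnn N))] /=.
rewrite sub0r normrN => lt_eps; exists (Fn N); apply: le_lt_trans (le_lt_trans (ler_norm _) lt_eps).
have fK' : fsupp (f - average (cmat (Fn N) f)) K.
  move=> k kK; apply: anorm_le0; apply: le_trans (average_cmat_dist _ _ (F0 N)) _.
  by rewrite fK // anorm0 mulr0.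
apply: le_trans (reduced_norm_le_sum fK') _; apply: ler_sum => k _.
exact: average_cmat_dist.
Qed.

End folner_approximation.

Section equivariant_maps.
Variables (R : realType) (G : groupType) (A B : gcstarAlgType R G).
Variables (phi : A -> B) (phiH : equivariant_hom phi).
Local Notation cA := (calg_of A).
Local Notation cB := (calg_of B).
Implicit Types (f : G -> cA) (F K : {fset G}).

Lemma equivariant_calg_hom : calg_hom (phi : cA -> cB).
Proof. by case: phiH. Qed.

Lemma comp_fsupp f F : fsupp f F -> fsupp (phi \o f : G -> cB) F.
Proof. by move=> fF g gF; rewrite /= fF // (calg_hom0 equivariant_calg_hom). Qed.

Lemma comp_Cc f : Cc (f : G -> A) -> Cc (phi \o f : G -> B).
Proof. by move=> /Cc_fsupp[F fF]; exact: fsupp_Cc (comp_fsupp fF). Qed.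

Lemma comp_sub f f' : phi \o (f - f') = (phi \o f : G -> cB) - (phi \o f').
Proof. by apply/funext => g; exact: (calg_homB equivariant_calg_hom). Qed.

Lemma comp_add f f' : phi \o (f + f') = (phi \o f : G -> cB) + (phi \o f').
Proof. by apply/funext => g; exact: (calg_homD equivariant_calg_hom). Qed.

Lemma matrix_map_cmat F f :
  matrix_map (phi : cA -> cB) (cmat F f) = cmat F (phi \o f : G -> cB).
Proof. by apply/funext => i; apply/funext => j; case: phiH => _; exact. Qed.

Lemma comp_average F (Y : matrix_calg cA F) :
  phi \o average Y = average (matrix_map (phi : cA -> cB) Y).
Proof.
apply/funext => k; rewrite /average /= (calg_homZ equivariant_calg_hom); congr (_ *: _).
rewrite (calg_hom_sum _ _ _ equivariant_calg_hom); apply: eq_bigr => i _.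
rewrite (calg_hom_sum _ _ _ equivariant_calg_hom); apply: eq_bigr => j _.
case: ifP => _; first by case: phiH => _; exact.
exact: (calg_hom0 equivariant_calg_hom).
Qed.

Lemma reduced_norm_comp_le f : Cc (f : G -> A) ->
  reduced_norm (phi \o f : G -> B) <= reduced_norm (f : G -> A).
Proof.
move=> fC; apply: reduced_norm_le_cmat (comp_Cc fC) (reduced_norm_ge0 fC) _ => F.
rewrite -matrix_map_cmat; apply: le_trans (cmat_le_reduced_norm F fC).
exact: (calg_hom_le (matrix_map_hom _ equivariant_calg_hom) (cmat F f)).
Qed.

(** As [phi] is injective on entries, a bounded lift of the image of [cmat F f] can only be
    [cmat F f] itself. This is what reflects Cauchy and null sequences through [phi]. *)
Lemma reduced_norm_le_comp f : injective phi -> Cc (f : G -> A) ->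
  reduced_norm (f : G -> A) <= 2 * reduced_norm (phi \o f : G -> B).
Proof.
move=> phiI fC; have pC := comp_Cc fC.
apply: (reduced_norm_le_cmat fC) => [|F]; first by rewrite mulr_ge0 ?reduced_norm_ge0.
have := cmat_le_reduced_norm F pC; rewrite -matrix_map_cmat => le_r.
apply/ler_addgt0Pr => e e0.
have [|T [TE Tc]] := @bounded_lift _ _ _ _ (matrix_map_hom _ equivariant_calg_hom)
    (cmat F f) (reduced_norm (phi \o f : G -> B) + e / 2).
  by rewrite (le_lt_trans le_r) // ltrDl divr_gt0.
have <- : T = cmat F f.
  apply/funext => i; apply/funext => j; apply: phiI.
  by have := congr1 (fun S : matrix_calg cB F => S i j) TE.
by apply: le_trans Tc _; rewrite mulrDr lerD2l mulrC divfK.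
Qed.

End equivariant_maps.

(** * Exactness of crossed products *)

Section cauchy_classes.
Variables (R : realType) (G : groupType) (A : gcstarAlgType R G).
Local Notation cA := (calg_of A).
Local Notation rn := (@reduced_norm R G A).
Implicit Types (u v w : nat -> G -> A).

Lemma sub_funE (f g : G -> A) : f \- g = (f - g : G -> cA).
Proof. by []. Qed.

Lemma CcB (f g : G -> A) : Cc f -> Cc g -> Cc (f - g : G -> cA).
Proof. by move=> fC gC; rewrite -scaleN1r; apply: CcD => //; exact: CcZ. Qed.

Lemma reduced_normN_le (f : G -> A) : Cc f -> rn (- f : G -> cA) <= rn f.
Proof.
move=> fC; have NfC : Cc (- f : G -> cA) by rewrite -scaleN1r; exact: CcZ.
apply: (reduced_norm_le_cmat NfC (reduced_norm_ge0 fC)) => F.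
have -> : cmat F (- f : G -> cA) = - cmat F f.
  by apply/funext => i; apply/funext => j; exact: (calg_homN (gact_calg_hom A _)).
by rewrite anormN cmat_le_reduced_norm.
Qed.

Lemma reduced_norm_distC (f g : G -> A) : Cc f -> Cc g ->
  rn (f - g : G -> cA) = rn (g - f : G -> cA).
Proof.
move=> fC gC; apply/eqP; rewrite eq_le -{1}opprB -{3}opprB.
by rewrite !reduced_normN_le //; exact: CcB.
Qed.

Lemma reduced_norm_triangle (g f h : G -> A) : Cc f -> Cc g -> Cc h ->
  rn (f - h : G -> cA) <= rn (f - g : G -> cA) + rn (g - h : G -> cA).
Proof.
move=> fC gC hC; have -> : (f - h : G -> cA) = (f - g : G -> cA) + (g - h : G -> cA).
  by rewrite addrA subrK.
by apply: reduced_normD; exact: CcB.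
Qed.

Lemma reduced_norm0 : rn 0 = 0.
Proof.
apply/eqP; rewrite eq_le (reduced_norm_ge0 (@Cc0 _ _ A)) andbT.
have f0 : fsupp (0 : G -> cA) fset0 by [].
by apply: le_trans (reduced_norm_le_sum f0) _; rewrite big1 // => k _; exact: anorm0.
Qed.

(** [reduced_norm] is controlled only on [Cc], hence the support hypotheses carried by the lemmas on
    this relation. *)
Definition seq_equiv u v := rn (u n \- v n) @[n --> \oo] --> (0 : R).

Lemma seq_equiv_le u v (e : nat -> R) : (forall n, Cc (u n)) -> (forall n, Cc (v n)) ->
  (forall n, rn (u n \- v n) <= e n) -> e @ \oo --> 0 -> seq_equiv u v.
Proof.
move=> uC vC le_e e0; apply: (@squeeze_cvgr _ _ _ _ (fun=> 0) e) => //; last exact: cvg_cst.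
by apply: nearW => n; rewrite le_e andbT; apply: reduced_norm_ge0; exact: CcB.
Qed.

Lemma seq_equiv_refl u : seq_equiv u u.
Proof.
rewrite /seq_equiv (_ : (fun n => _) = fun=> 0); first exact: cvg_cst.
by apply/funext => n; rewrite sub_funE subrr reduced_norm0.
Qed.

Lemma seq_equiv_sym u v : (forall n, Cc (u n)) -> (forall n, Cc (v n)) ->
  seq_equiv u v -> seq_equiv v u.
Proof.
move=> uC vC; rewrite /seq_equiv (_ : (fun n => rn (u n \- v n)) = fun n => rn (v n \- u n)) //.
by apply/funext => n; exact: reduced_norm_distC.
Qed.

Lemma seq_equiv_trans v u w : (forall n, Cc (u n)) -> (forall n, Cc (v n)) ->
  (forall n, Cc (w n)) -> seq_equiv u v -> seq_equiv v w -> seq_equiv u w.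
Proof.
move=> uC vC wC uv vw.
apply: (@seq_equiv_le _ _ (fun n => rn (u n \- v n) + rn (v n \- w n))) => //.
  by move=> n; exact: reduced_norm_triangle.
by have := cvgD uv vw; rewrite addr0; exact.
Qed.

Lemma reduced_cauchy_equiv u v : reduced_cauchy u -> (forall n, Cc (v n)) ->
  seq_equiv u v -> reduced_cauchy v.
Proof.
move=> [uC cu] vC uv; split=> // eps eps0.
have e3 : 0 < eps / 3 by rewrite divr_gt0.
have [N hN] := cu _ e3.
have /cvgrPdist_lt/(_ _ e3)[N' _ hN'] := uv.
exists (maxn N N') => m n; rewrite !geq_max => /andP[Nm N'm] /andP[Nn N'n].
have small k : (N' <= k)%N -> rn (u k - v k : G -> cA) < eps / 3.
  by move=> /hN' /=; rewrite sub0r normrN; exact: le_lt_trans (ler_norm _).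
apply: le_lt_trans (reduced_norm_triangle (vC m) (uC m) (vC n)) _.
rewrite (reduced_norm_distC (vC m) (uC m)).
have := reduced_norm_triangle (uC m) (uC n) (vC n).
have := hN m n Nm Nn; have := small m N'm; have := small n N'n.
rewrite sub_funE; lra.
Qed.

Lemma reduced_class_refl u : reduced_cauchy u -> reduced_class u u.
Proof. by move=> uc; split=> //; exact: seq_equiv_refl. Qed.

Lemma reduced_class_eqP u v : reduced_cauchy u -> reduced_cauchy v ->
  reduced_class u = reduced_class v <-> seq_equiv u v.
Proof.
move=> uc vc; have [[uC _] [vC _]] := (uc, vc); split=> [uv|uv].
  by have [] : reduced_class u v by rewrite uv; exact: reduced_class_refl.
apply/seteqP; split=> w [wc ew]; split=> //; have [wC _] := wc.
  by apply: (seq_equiv_trans vC uC wC) => //; exact: seq_equiv_sym.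
exact: (seq_equiv_trans uC vC wC).
Qed.

Lemma reduced_cauchy0 : reduced_cauchy (fun _ _ => 0 : A).
Proof.
split=> [n|eps eps0]; first exact: (@Cc0 _ _ A).
by exists 0 => m n _ _; rewrite sub_funE subrr reduced_norm0.
Qed.

End cauchy_classes.

Section crossed_product_maps.
Variables (R : realType) (G : groupType) (A B : gcstarAlgType R G).
Variables (phi : A -> B) (phiH : equivariant_hom phi).
Implicit Types (u v : nat -> G -> A).

Lemma seq_equiv_comp u v : (forall n, Cc (u n)) -> (forall n, Cc (v n)) ->
  seq_equiv u v -> seq_equiv (fun n => phi \o u n) (fun n => phi \o v n).
Proof.
move=> uC vC uv; apply: seq_equiv_le uv => n; [exact: comp_Cc|exact: comp_Cc|].
by rewrite sub_funE -(comp_sub phiH); apply: (reduced_norm_comp_le phiH); exact: CcB.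
Qed.

Lemma reduced_cauchy_comp u : reduced_cauchy u -> reduced_cauchy (fun n => phi \o u n).
Proof.
move=> [uC cu]; split=> [n|eps /cu[N hN]]; first exact: comp_Cc.
exists N => m n Nm Nn; apply: le_lt_trans (hN m n Nm Nn).
by rewrite sub_funE -(comp_sub phiH); apply: (reduced_norm_comp_le phiH); exact: CcB.
Qed.

(** By contractivity all representatives have equivalent images, so the union in
    [crossed_product_map] is a single class. *)
Lemma crossed_product_map_class u : reduced_cauchy u ->
  crossed_product_map phi (reduced_class u) = reduced_class (fun n => phi \o u n).
Proof.
move=> uc; apply/seteqP; split=> [w [v [vc uv] vw]|w uw]; last first.
  by exists u => //; exact: reduced_class_refl.
rewrite (_ : reduced_class _ = reduced_class (fun n => phi \o v n)) //.
apply/reduced_class_eqP; [exact: reduced_cauchy_comp|exact: reduced_cauchy_comp|].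
by apply: seq_equiv_comp => //; [case: uc|case: vc].
Qed.

Hypothesis phiI : injective phi.

Lemma seq_equiv_comp_inj u v : (forall n, Cc (u n)) -> (forall n, Cc (v n)) ->
  seq_equiv (fun n => phi \o u n) (fun n => phi \o v n) -> seq_equiv u v.
Proof.
move=> uC vC uv.
apply: (@seq_equiv_le _ _ _ _ _ (fun n => 2 * reduced_norm ((phi \o u n) \- (phi \o v n)))) => //.
  move=> n; rewrite !sub_funE -(comp_sub phiH).
  by apply: (reduced_norm_le_comp phiH) => //; exact: CcB.
by have := cvgM (@cvg_cst _ (2 : R) _ \oo _) uv; rewrite mulr0; exact.
Qed.

Lemma reduced_cauchy_comp_inj u : (forall n, Cc (u n)) ->
  reduced_cauchy (fun n => phi \o u n) -> reduced_cauchy u.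
Proof.
move=> uC [_ cu]; split=> // eps eps0.
have [N hN] := cu (eps / 2) (divr_gt0 eps0 (ltr0n _ 2)); exists N => m n Nm Nn.
have := hN m n Nm Nn; rewrite sub_funE -(comp_sub phiH).
have := reduced_norm_le_comp phiH phiI (CcB (uC m) (uC n)).
rewrite (sub_funE (u m)); lra.
Qed.

End crossed_product_maps.

Section exactness.
Variables (R : realType) (G : groupType) (B C D : gcstarAlgType R G).
Variables (phi : B -> C) (psi : C -> D).
Hypotheses (phiH : equivariant_hom phi) (psiH : equivariant_hom psi).
Hypothesis exact_BCD : short_exact [set: B] [set: C] [set: D] 0 phi psi.
Hypothesis amenableG : amenable R G.

Let phiI : injective phi.
Proof. by case: exact_BCD => I _ _ x y; apply: I; rewrite inE. Qed.

Let psi_phi x : psi (phi x) = 0.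
Proof.
case: exact_BCD => _ E _; have : (phi @` [set: B]) (phi x) by exists x.
by rewrite E => -[].
Qed.

Let psi_ker y : psi y = 0 -> exists x, phi x = y.
Proof.
case: exact_BCD => _ E _ y0; have : (phi @` [set: B]) y by rewrite E.
by move=> [x _ <-]; exists x.
Qed.

Let psi_surj z : exists y, psi y = z.
Proof.
case: exact_BCD => _ _ E; have : (psi @` [set: C]) z by rewrite E.
by move=> [y _ <-]; exists y.
Qed.

Lemma approximation_from_ideal (f : G -> C) (eps : R) : Cc f -> 0 < eps ->
  exists b : G -> B, Cc b /\ reduced_norm (f \- (phi \o b)) <= 2 * reduced_norm (psi \o f) + eps.
Proof.
move=> fC eps0; have e2 : 0 < eps / 2 by rewrite divr_gt0.
have e4 : 0 < eps / 4 by rewrite divr_gt0.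
have [Fn Fol] := amenableG; have [F lt_e] := folner_average fC Fol e2.
have pC := comp_Cc psiH fC.
have psi_hom := equivariant_calg_hom psiH.
have [|T [TE Tc]] := @bounded_lift _ _ _ _ (matrix_map_hom F psi_hom) (cmat F f)
    (reduced_norm (psi \o f) + eps / 4).
  rewrite (matrix_map_cmat psiH).
  by apply: le_lt_trans (cmat_le_reduced_norm F pC) _; rewrite ltrDl.
(* Exactness in the middle is used entry by entry: [cmat F f] and [T] have the same image over
   [D]. *)
have /choice[W WE] (ij : F * F) : exists x, phi x = cmat F f ij.1 ij.2 - T ij.1 ij.2.
  apply: psi_ker; have := congr1 (fun S : matrix_calg (calg_of D) F => S ij.1 ij.2) TE.
  rewrite /matrix_map => E; rewrite [LHS](calg_homB psi_hom).
  by apply/eqP; rewrite subr_eq0 E.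
pose Y : matrix_calg (calg_of B) F := fun i j => W (i, j).
have YE : matrix_map (phi : calg_of B -> calg_of C) Y = cmat F f - T.
  by apply/funext => i; apply/funext => j; exact: (WE (i, j)).
have YC : Cc (average Y : G -> B) by exact: fsupp_Cc (average_fsupp Y).
have TC : Cc (average T : G -> C) by exact: fsupp_Cc (average_fsupp T).
have fFC : Cc (average (cmat F f) : G -> C) by exact: fsupp_Cc (average_fsupp _).
exists (average Y); split=> //.
(* The difference is the Folner error of [f] plus [average T], whose reduced norm is at most that of
   [T]. *)
rewrite sub_funE (comp_average phiH) YE averageB opprB addrCA addrC.
apply: le_trans (reduced_normD _ TC) _; first exact: CcB.
have := average_norm_le T; move: lt_e; lra.
Qed.

(** Any pointwise lift, however large, is corrected by subtracting its approximation from the ideal,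
    which [psi] kills. *)
Lemma bounded_lift_Cc (w : G -> D) (eps : R) : Cc w -> 0 < eps ->
  exists f : G -> C, [/\ Cc f, psi \o f = w & reduced_norm f <= 2 * reduced_norm w + eps].
Proof.
move=> wC eps0; have /choice[s sE] := psi_surj.
(* [s 0] may be nonzero; the test keeps the support finite. *)
pose f0 g := if w g == 0 then 0 else s (w g).
have f0C : Cc f0.
  by apply: sub_finite_set wC => g /=; apply: contraNN => /eqP w0; rewrite /f0 w0 eqxx.
have f0E : psi \o f0 = w.
  apply/funext => g; rewrite /= /f0; case: eqP => [->|_]; last exact: sE.
  exact: (calg_hom0 (equivariant_calg_hom psiH)).
have [b [bC le_b]] := approximation_from_ideal f0C eps0.
exists (f0 \- (phi \o b)); split.
- by rewrite sub_funE; apply: CcB => //; exact: comp_Cc.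
- rewrite sub_funE (comp_sub psiH) f0E (_ : psi \o (phi \o b) = 0 :> (G -> calg_of D)).
    by rewrite subr0.
  by apply/funext => g; exact: psi_phi.
- by move: le_b; rewrite f0E.
Qed.

Lemma reduced_cauchy_lift (w : nat -> G -> D) : reduced_cauchy w ->
  exists u : nat -> G -> C, reduced_cauchy u /\ seq_equiv (fun n => psi \o u n) w.
Proof.
move=> wc; have [wC cw] := wc.
have half0 j : 0 < 2^-1 ^+ j :> R by rewrite exprn_gt0 // invr_gt0.
have /choice[N NE] (j : nat) : exists N, forall m n, (N <= m)%N -> (N <= n)%N ->
    reduced_norm (w m \- w n) < 2^-1 ^+ j.
  exact: cw.
(* [m] is monotone; it passes [N j], so that the increments of [w] along it are below [2^-j], and it
   passes [j], so that it is cofinal. *)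
pose fix m j := if j is j'.+1 then maxn (m j') (maxn (N j) j) else N 0.
have mS j : (m j <= m j.+1)%N by rewrite leq_maxl.
have Nm j : (N j <= m j)%N by case: j => // j; rewrite /= !leq_max leqnn orbT.
have jm j : (j <= m j)%N by case: j => // j; rewrite /= !leq_max leqnn !orbT.
have dC j : Cc (w (m j.+1) \- w (m j)) by rewrite sub_funE; exact: CcB.
(* The bound [3 * 2^-j] is twice the norm of the increment plus the error [2^-j] of the lift. *)
have /choice[l lE] (j : nat) : exists f : G -> C, [/\ Cc f,
    psi \o f = w (m j.+1) \- w (m j) & reduced_norm f <= 3 * 2^-1 ^+ j].
  have [f [fC fE fn]] := bounded_lift_Cc (dC j) (half0 j); exists f; split=> //.
  have := NE j _ _ (leq_trans (Nm j) (mS j)) (Nm j); move: fn; lra.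
have [l0 [l0C l0E _]] := bounded_lift_Cc (wC (m 0)) ltr01.
pose fix u j : G -> calg_of C := if j is j'.+1 then u j' + l j' else l0.
have uC j : Cc (u j : G -> C) by elim: j => [|j IHj] //=; apply: CcD => //; case: (lE j).
have uE j : psi \o u j = w (m j).
  elim: j => [|j IHj]; first exact: l0E.
  rewrite [u _]/= (comp_add psiH) IHj; case: (lE j) => _ -> _.
  by rewrite sub_funE addrC subrK.
have uc : reduced_cauchy (u : nat -> G -> C).
  (* The majorant [- 6 * 2^-n] has increments [3 * 2^-n], the bounds on the [l n]. *)
  split=> //; apply: (@seq_cauchy_dominated R (G -> calg_of C) (@reduced_norm R G C) u
    (fun n => - 6 * 2^-1 ^+ n)).
  - by move=> i j; exact: reduced_norm_distC.
  - apply: is_cvgM; first exact: is_cvg_cst.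
    by apply/cvg_ex; exists 0; apply: cvg_expr; rewrite ger0_norm ?invr_ge0 // invf_lt1 // ltr1n.
  - move=> i j; elim: j => [|j IHj].
      by rewrite leqn0 => /eqP ->; rewrite !subrr reduced_norm0.
    rewrite leq_eqVlt => /predU1P[->|]; first by rewrite !subrr reduced_norm0.
    rewrite ltnS => /IHj le_ij.
    apply: le_trans (reduced_norm_triangle (uC j.+1) (uC j) (uC i)) _.
    have -> : (u j.+1 - u j : G -> calg_of C) = l j by rewrite /= addrC addKr.
    case: (lE j) => _ _; move: le_ij; rewrite exprS; lra.
exists u; split=> //.
(* [psi \o u] is a subsequence of the Cauchy sequence [w], hence equivalent to it. *)
apply/(seq_equiv_sym wC); first by move=> n; exact: comp_Cc.
rewrite /seq_equiv; apply/cvgrPdist_lt => eps /cw[N' hN']; exists N' => // n /= N'n.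
rewrite sub0r normrN uE ger0_norm.
  by apply: hN' => //; exact: leq_trans N'n (jm n).
by apply: reduced_norm_ge0; rewrite sub_funE; exact: CcB.
Qed.

Lemma crossed_product_short_exact :
  short_exact (@crossed_product R G B) (@crossed_product R G C)
    (@crossed_product R G D) (@crossed_product0 R G D)
    (crossed_product_map phi) (crossed_product_map psi).
Proof.
split.
- move=> X Y; rewrite !inE => -[u uc <-] [v vc <-].
  rewrite !crossed_product_map_class // => /reduced_class_eqP uv.
  have [[uC _] [vC _]] := (uc, vc).
  apply/reduced_class_eqP => //; apply: (seq_equiv_comp_inj phiH) => //.
  by apply: uv; exact: reduced_cauchy_comp.
- apply/seteqP; split=> [_ [_ [u uc <-] <-]|X [[u uc <-]]].
    have puc := reduced_cauchy_comp phiH uc.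
    rewrite crossed_product_map_class //; split; first by exists (fun n => phi \o u n).
    rewrite crossed_product_map_class //; congr reduced_class.
    by apply/funext => n; apply/funext => g; exact: psi_phi.
  rewrite crossed_product_map_class // => /reduced_class_eqP psi_u.
  have [uC _] := uc; have puC n := comp_Cc psiH (uC n).
  have {}psi_u : seq_equiv (fun n => psi \o u n) (fun _ _ => 0).
    by apply: psi_u; [exact: reduced_cauchy_comp|exact: reduced_cauchy0].
  (* Both error terms tend to 0, so [phi \o b n] represents the class of [u]; injectivity of [phi]
     then makes [b] itself Cauchy. *)
  have /choice[b bE] (n : nat) : exists b : G -> B, Cc b /\
      reduced_norm (u n \- (phi \o b)) <= 2 * reduced_norm (psi \o u n) + n.+1%:R^-1.
    by apply: approximation_from_ideal => //; rewrite invr_gt0.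
  have bC n : Cc (b n) by case: (bE n).
  have pbC n : Cc (phi \o b n) by exact: comp_Cc.
  have ub : seq_equiv u (fun n => phi \o b n).
    apply: (seq_equiv_le (e := fun n =>
      2 * reduced_norm ((psi \o u n) \- (fun=> 0)) + n.+1%:R^-1)) => //.
      move=> n; case: (bE n) => _; rewrite [(psi \o u n) \- _](_ : _ = psi \o u n) //.
      by rewrite sub_funE; exact: subr0.
    have := cvgD (cvgM (@cvg_cst _ (2 : R) _ \oo _) psi_u) (@cvg_harmonic R).
    by rewrite mulr0 addr0; exact.
  have pbc := reduced_cauchy_equiv uc pbC ub.
  have bc := reduced_cauchy_comp_inj phiH phiI bC pbc.
  exists (reduced_class b); first by exists b.
  rewrite crossed_product_map_class //; apply/reduced_class_eqP => //.
  exact: seq_equiv_sym.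
- apply/seteqP; split=> [_ [_ [u uc <-] <-]|_ [w wc <-]].
    rewrite crossed_product_map_class //; exists (fun n => psi \o u n) => //.
    exact: reduced_cauchy_comp.
  have [u [uc uw]] := reduced_cauchy_lift wc; exists (reduced_class u); first by exists u.
  rewrite crossed_product_map_class //; apply/reduced_class_eqP => //.
  exact: reduced_cauchy_comp.
Qed.

End exactness.

(** * Property A *)

(** Stated additively, free of truncated subtraction, for [lia]. *)
Lemma card_fset_symdiff (K : choiceType) (X Y : {fset K}) :
  (#|` fset_symdiff X Y| + (#|` X `&` Y| + #|` X `&` Y|) = #|` X| + #|` Y|)%N%fset.
Proof.
have XY0 : ((X `\` Y) `&` (Y `\` X) = fset0)%fset.
  by apply/fsetP => z; rewrite !inE; case: (z \in X); case: (z \in Y).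
rewrite /fset_symdiff cardfsU XY0 cardfs0 subn0 -[in RHS](cardfsID Y X).
by rewrite -[in RHS](cardfsID X Y) (fsetIC Y X); lia.
Qed.

Lemma amenable_property_A (R : realType) (G : groupType) : amenable R G -> property_A R G.
Proof.
move=> [Fn [F0 Fcvg]] E eps eps0.
pose d g n : R := #|` fset_symdiff (left_translate g (Fn n)) (Fn n)|%:R / #|` Fn n|%:R.
(* With [m] the size of [F], [c] that of the intersection and [a = 2 (m - c)] that of the symmetric
   difference, the target [a < eps c] reads [a (1 + eps / 2) < eps m], and [a < delta m] gives
   [a (1 + eps) < eps m]. *)
pose delta := eps / (1 + eps).
have delta0 : 0 < delta by rewrite divr_gt0 // addr_gt0.
have : \sum_(g : E) d (val g) n @[n --> \oo] --> 0 by apply: cvg_sum0 => g; exact: Fcvg.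
move/cvgrPdist_lt => /(_ _ delta0)[N _ /(_ N (leqnn N))] /=.
rewrite sub0r normrN => /(le_lt_trans (ler_norm _)) lt_d.
have {}lt_d g : g \in E -> d g N < delta.
  move=> gE; apply: le_lt_trans lt_d; rewrite (bigD1 [` gE]%fset) //= lerDl.
  by apply: sumr_ge0 => h _; rewrite divr_ge0.
have /fset0Pn[x0 x0F] := F0 N; set F := Fn N in x0F lt_d.
pose S := [fset x * x0^-1 | x in F]%g%fset.
exists S, (fun g => [fset ((g * x * x0^-1)%g, 1%N) | x in F]%fset).
split.
- by move=> g; apply/fset0Pn; exists (g, 1%N); apply/imfsetP; exists x0; rewrite //= mulgK.
- by move=> g; apply/imfsetP; exists x0; rewrite //= mulgK.
- move=> g h ghE; set k := (g^-1 * h)%g in ghE.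
  (* Since [h x = g (k x)], the sets attached to [g] and [h] are the images of [F] and [k F] under
     one injection, so all sizes can be computed with [F] and [k F]. *)
  pose iota (x : G) : G * nat := ((g * x * x0^-1)%g, 1%N).
  have iotaI : injective iota by move=> x y [] /mulIg /mulgI.
  have -> : [fset ((h * x * x0^-1)%g, 1%N) | x in F]%fset = (iota @` left_translate k F)%fset.
    rewrite /left_translate -imfset_comp; apply: eq_imfset => // x.
    by rewrite /iota /k /= !mulgA mulgV mul1g.
  rewrite -/(iota @` F)%fset.
  have := card_fset_symdiff (iota @` F)%fset (iota @` left_translate k F)%fset.
  have := card_fset_symdiff (left_translate k F) F.
  rewrite -imfsetI; last by move=> x y _ _; exact: iotaI.
  have card_kF : #|` left_translate k F| = #|` F|.
    by rewrite card_imfset //; exact: mulgI.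
  have card_iota X : #|` (iota @` X)%fset| = #|` X| by exact: card_imfset.
  rewrite !card_iota card_kF (fsetIC F) => sd1 sd2.
  have sdE : #|` fset_symdiff (iota @` F)%fset (iota @` left_translate k F)%fset| =
      #|` fset_symdiff (left_translate k F) F| by lia.
  have F_gt0 : 0 < #|` F|%:R :> R by rewrite ltr0n cardfs_gt0 F0.
  have := lt_d _ ghE; rewrite /d -/F sdE ltr_pdivrMr // /delta mulrAC.
  rewrite ltr_pdivlMr ?addr_gt0 // => lt_sd.
  have := congr1 (fun n => n%:R : R) sd1; rewrite !natrD => sdR.
  have sd0 : 0 <= #|` fset_symdiff (left_translate k F) F|%:R :> R by [].
  move: sdR lt_sd sd0; set a := #|` fset_symdiff _ _|%:R; set c := #|` _|%:R; set m := #|` F|%:R.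
  nra.
- by move=> g h m /imfsetP[x /= xF [-> _]]; apply/imfsetP; exists x; rewrite // -!mulgA mulKg.
Qed.

Theorem corollary3p5 (R : realType) (G : groupType) :
  amenable R G -> exact_group R G /\ property_A R G.
Proof.
move=> amG; split; last exact: amenable_property_A.
by move=> B C D phi psi phiH psiH E; exact: crossed_product_short_exact.
Qed.
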